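(* Let $d\ge1$, let $\nu\ge\frac d2+1$ be an integer and let $\lambda>0$. Let $\mathbf c=\{c_{\mathbf k}\}_{\mathbf k\in\Lambda}$ and $\mathbf m=\{m_{\mathbf k}\}_{\mathbf k\in\Lambda_0}$ be real with $c_{\mathbf k}=c_{-\mathbf k}$, $m_{\mathbf k}=m_{-\mathbf k}$, and assume that there is a nonnegative $\Phi_0\in L^1(\mathbb T^d)$, strictly positive on some open ball in $\mathbb T^d$, with $c_{\mathbf k}=\int_{\mathbb T^d}e^{i\langle\mathbf k,\boldsymbol\theta\rangle}\Phi_0\,\mathrm d\mu$ for all $\mathbf k\in\Lambda$. Let $(\hat P,\hat Q)$, with coefficient vectors $(\hat{\mathbf p},\hat{\mathbf q})$, be the (unique) solution of the continuous regularized dual problem $$\min\ J_{\nu,\lambda}(P,Q)\quad\text{s.t. }P\in\overline{\mathfrak P}_{+,o},\ Q\in\overline{\mathfrak P}_+ .$$ For $\mathbf N\in\mathbb N_+^d$ with $\min(\mathbf N)$ sufficiently large (so that the problem below is uniquely solvable), let $(\hat P_{\mathbf N},\hat Q_{\mathbf N})$, with coefficient vectors $(\hat{\mathbf p}_{\mathbf N},\hat{\mathbf q}_{\mathbf N})$, be the unique solution of the discrete regularized dual problem $$\min_{P,Q}\ J^{\mathbf N}_{\nu,\lambda}(P,Q)\quad\text{s.t. }p_{\mathbf 0}=1,\ P>0\text{ and }Q>0\text{ at every point of }\mathbb T^d_{\mathbf N}.$$ Then, along any sequence of such $\mathbf N$ with $\min(\mathbf N)\to\infty$, the sequence of coefficient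 vectors $(\hat{\mathbf p}_{\mathbf N},\hat{\mathbf q}_{\mathbf N})$ is bounded in norm and has a unique limit point, namely $(\hat{\mathbf p},\hat{\mathbf q})$.
   Context: $\mathbb T=[0,2\pi)$, identified with the circle, so that $\boldsymbol\theta\in\mathbb T^d$ corresponds to the point $e^{i\boldsymbol\theta}=(e^{i\theta_1},\dots,e^{i\theta_d})$ of the $d$-torus; $\mathrm d\mu(\boldsymbol\theta)=(2\pi)^{-d}\prod_{j=1}^d\mathrm d\theta_j$; $\langle\mathbf k,\boldsymbol\theta\rangle=\sum_j k_j\theta_j$. The index set $\Lambda\subset\mathbb Z^d$ is fixed, finite, contains $\mathbf 0$, and satisfies $\mathbf k\in\Lambda\Rightarrow-\mathbf k\in\Lambda$; $\Lambda_0=\Lambda\setminus\{\mathbf 0\}$. Polynomials: $P(e^{i\boldsymbol\theta})=\sum_{\mathbf k\in\Lambda}p_{\mathbf k}e^{-i\langle\mathbf k,\boldsymbol\theta\rangle}$, $Q(e^{i\boldsymbol\theta})=\sum_{\mathbf k\in\Lambda}q_{\mathbf k}e^{-i\langle\mathbf k,\boldsymbol\theta\rangle}$ with real coefficients, $p_{-\mathbf k}=p_{\mathbf k}$, $q_{-\mathbf k}=q_{\mathbf k}$; coefficient vectors are $\mathbf p=\{p_{\mathbf k}\}_{\mathbf k\in\Lambda_0}$ (with $p_{\mathbf 0}=1$) and $\mathbf q=\{q_{\mathbf k}\}_{\mathbf k\in\Lambda}$, with $\|(\mathbf p,\mathbf q)\|=\big(\sum_{\Lambda_0}|p_{\mathbf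 k}|^2\big)^{1/2}+\big(\sum_{\Lambda}|q_{\mathbf k}|^2\big)^{1/2}$. $\mathfrak P_+$ is the set of such polynomials strictly positive on $\mathbb T^d$; $\mathfrak P_{+,o}=\{P\in\mathfrak P_+:p_{\mathbf 0}=1\}$; bars denote closures in the coefficient space. Continuous regularized dual function: $$J_{\nu,\lambda}(P,Q)=\frac1{\nu-1}\int_{\mathbb T^d}\frac{P^\nu}{Q^{\nu-1}}\,\mathrm d\mu+\langle\mathbf q,\mathbf c\rangle-\langle\mathbf p,\mathbf m\rangle+\frac{\lambda}{\nu-1}\int_{\mathbb T^d}\frac1{P^{\nu-1}}\,\mathrm d\mu\in(-\infty,+\infty],$$ with $\langle\mathbf q,\mathbf c\rangle=\sum_{\mathbf k\in\Lambda}q_{\mathbf k}c_{\mathbf k}$, $\langle\mathbf p,\mathbf m\rangle=\sum_{\mathbf k\in\Lambda}p_{\mathbf k}m_{\mathbf k}$, $p_{\mathbf 0}=1$, $m_{\mathbf 0}$ an arbitrary fixed real number; integrands are $[0,+\infty]$-valued with $a/0=+\infty$ for $a>0$ (values at points where $P=Q=0$ are irrelevant since the zero set of $P$ is null), so $J_{\nu,\lambda}(P,0)=+\infty$. Under the stated hypotheses its minimizer over $\overline{\mathfrak P}_{+,o}\times\overline{\mathfrak P}_+$ exists, is unique and lies in $\mathfrak P_{+,o}\times\mathfrak P_+$. Discrete problem: for $\mathbf N=(N_1,\dots,N_d)\in\mathbb N_+^d$, $|\mathbf N|=\prod_jN_j$, $\min(\mathbf N)=\min_jN_j$, the grid is $\mathbb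 T^d_{\mathbf N}=\{(\tfrac{2\pi}{N_1}\ell_1,\dots,\tfrac{2\pi}{N_d}\ell_d):0\le\ell_j\le N_j-1\}$ and $\mathrm d\eta_{\mathbf N}$ is the measure putting mass $1/|\mathbf N|$ at each grid point. $J^{\mathbf N}_{\nu,\lambda}$ is defined by the same formula as $J_{\nu,\lambda}$ with $\mathrm d\mu$ replaced by $\mathrm d\eta_{\mathbf N}$ (and the same data $\mathbf c,\mathbf m$, same $m_{\mathbf 0}$). *)

(* Defs.v *)
From HB Require Import structures.
From mathcomp Require Import all_boot all_order all_algebra finmap.
From mathcomp Require Import all_classical all_reals all_analysis.
From mathcomp Require Import complex.

Set Implicit Arguments.
Unset Strict Implicit.
Unset Printing Implicit Defensive.

Import Order.TTheory GRing.Theory Num.Theory.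
Import numFieldNormedType.Exports.

Local Open Scope classical_set_scope.
Local Open Scope ring_scope.

Section Torus.
Variable R : realType.

(* The d-torus is represented by the cube [0, 2 pi)^d inside d.-tuple R. *)
Definition torus (d : nat) : set (d.-tuple R) :=
  [set t | forall j : 'I_d, 0 <= tnth t j < 2 * pi].

Definition expi (x : R) : R[i] := Complex (cos x) (sin x).

(* Open balls for the Euclidean distance between the points
   (expi t_1, ..., expi t_d) of the torus. *)
Definition torus_ball (d : nat) (t0 : d.-tuple R) (r : R) : set (d.-tuple R) :=
  [set t | torus t /\
    Num.sqrt (\sum_(j < d)
      Normc.normc (expi (tnth t j) - expi (tnth t0 j)) ^+ 2) < r].

Definition pairing (d : nat) (k : 'rV[int]_d) (t : d.-tuple R) : R :=
  \sum_(j < d) (k ord0 j)%:~R * tnth t j.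

Fact pi2_gt0 : 0 < 2 * pi :> R.
Proof. by rewrite mulr_gt0 ?pi_gt0. Qed.

Definition circle_measure : probability (measurableTypeR R) R :=
  uniform_prob pi2_gt0.

(* [measurableTypeR R] carries the Lebesgue measure of the library; it is [R]
   with the same sigma-algebra, under another display. *)
Definition tuple_cons (n : nat) (x : measurableTypeR R * n.-tuple R) :
  n.+1.-tuple R := [tuple of x.1 :: x.2].

Lemma measurable_tuple_cons n : measurable_fun setT (@tuple_cons n).
Proof. exact: (measurable_cons measurable_fst measurable_snd). Qed.

HB.instance Definition _ n := isMeasurableFun.Build _ _ _ _ (@tuple_cons n)
  (@measurable_tuple_cons n).

(* d mu = (2 pi)^-d dt_1 ... dt_d, as the d-fold product of (2 pi)^-1 dt on
   [0, 2 pi]. *)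
Fixpoint torus_measure (d : nat) : probability (d.-tuple R) R :=
  if d is n.+1 return probability (d.-tuple R) R
  then distribution (circle_measure \x torus_measure n)%E (@tuple_cons n)
  else \d_([tuple] : 0.-tuple R).

Section Grid.
Variables (d : nat) (N : 'I_d -> nat).

Definition grid_index := {dffun forall j : 'I_d, 'I_(N j)}.

Definition grid_point (l : grid_index) : d.-tuple R :=
  [tuple 2 * pi / (N j)%:R * (l j)%:R | j < d].

Definition grid : set (d.-tuple R) := range grid_point.

Definition grid_measure (A : set (d.-tuple R)) : \bar R :=
  (\sum_(l : grid_index)
    ((\prod_(j < d) N j)%N%:R^-1)%:E * \d_(grid_point l) A)%E.

Let grid_measure0 : grid_measure set0 = 0%E.
Proof. by rewrite /grid_measure big1// => l _; rewrite measure0 mule0. Qed.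

Let grid_measure_ge0 A : (0 <= grid_measure A)%E.
Proof.
by apply: sume_ge0 => l _; rewrite mule_ge0// lee_fin invr_ge0.
Qed.

Let grid_measure_sigma_additive : semi_sigma_additive grid_measure.
Proof.
move=> F mF tF mUF; rewrite [X in _ --> X](_ : _ =
    lim ((fun n => \sum_(0 <= i < n) grid_measure (F i))%E @ \oo)).
  by apply: is_cvg_ereal_nneg_natsum => k _.
rewrite nneseries_sum//; last first.
  by move=> l k _; rewrite mule_ge0// lee_fin invr_ge0.
apply: eq_bigr => /= l _; rewrite nneseriesZl//.
by rewrite measure_semi_bigcup.
Qed.

HB.instance Definition _ := isMeasure.Build _ _ _ grid_measure
  grid_measure0 grid_measure_ge0 grid_measure_sigma_additive.

End Grid.

(* min_j N_j; the neutral element max_j N_j is harmless as soon as 0 < d. *)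
Definition min_size (d : nat) (N : 'I_d -> nat) : nat :=
  \big[minn/(\max_(j < d) N j)%N]_(j < d) N j.

End Torus.
Arguments torus {R d}.

Section Problem.
Variables (R : realType) (d : nat) (L : {fset 'rV[int]_d}).

(* Families indexed by L, with the topology of the finite-dimensional space
   R^L. A polynomial P with p_0 = 1 is represented by the family (p_k) for k
   in all of L, with the constraint [unit_const] below. *)
Definition coefs := {ptws L -> R}.

Implicit Types (p q : coefs) (t : d.-tuple R).

Definition even_coefs (p : L -> R) : Prop :=
  forall k l : L, val l = - val k -> p l = p k.

Definition unit_const p : Prop := forall k : L, val k = 0 -> p k = 1.

Definition trig_poly p t : R[i] :=
  \sum_(k : L) (p k)%:C%C * expi (- pairing (val k) t).

(* On even families [trig_poly p t] is real. *)
Definition poly_val p t : R := complex.Re (trig_poly p t).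

(* The order of R[i] is partial: 0 < z means that z is real and positive. *)
Definition pos_polys : set coefs :=
  [set p | even_coefs p /\ forall t, torus t -> 0 < trig_poly p t].

Definition pos_polys1 : set coefs := pos_polys `&` [set p | unit_const p].

Definition coef_norm (x : coefs * coefs) : R :=
  Num.sqrt (\sum_(k : L | val k != 0) `|x.1 k| ^+ 2) +
  Num.sqrt (\sum_(k : L) `|x.2 k| ^+ 2).

Definition fourier_coef (f : d.-tuple R -> R) (k : 'rV[int]_d) : R[i] :=
  Complex
    (\int[torus_measure R d]_(t in torus) (cos (pairing k t) * f t))
    (\int[torus_measure R d]_(t in torus) (sin (pairing k t) * f t)).

(* The dual function with respect to a measure mu on the torus. In \bar R,
   a / 0 = +oo for a > 0, and 0 / 0 = 0 * +oo = 0. *)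
Definition dual_fun (mu : {measure set (d.-tuple R) -> \bar R}) (nu : nat)
    (lambda : R) (c m : L -> R) (x : coefs * coefs) : \bar R :=
  let P := poly_val x.1 in
  let Q := poly_val x.2 in
  ( (1 / (nu%:R - 1))%:E *
      \int[mu]_(t in torus) ((P t ^+ nu)%:E / (Q t ^+ nu.-1)%:E)
    + (\sum_(k : L) x.2 k * c k)%:E
    - (\sum_(k : L) x.1 k * m k)%:E
    + (lambda / (nu%:R - 1))%:E *
      \int[mu]_(t in torus) (1 / (P t ^+ nu.-1)%:E))%E.

Definition is_argmin (T : Type) (J : T -> \bar R) (F : set T) (x : T) : Prop :=
  F x /\ forall y, F y -> (J x <= J y)%E.

Definition dual_solution (nu : nat) (lambda : R) (c m : L -> R) :
    set (coefs * coefs) :=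
  is_argmin (dual_fun (torus_measure R d) nu lambda c m)
    (closure pos_polys1 `*` closure pos_polys).

Definition grid_feasible (N : 'I_d -> nat) : set (coefs * coefs) :=
  [set x | [/\ even_coefs x.1, even_coefs x.2, unit_const x.1 &
    forall t, grid N t -> 0 < trig_poly x.1 t /\ 0 < trig_poly x.2 t]].

Definition grid_dual_solution (N : 'I_d -> nat) (nu : nat) (lambda : R)
    (c m : L -> R) : set (coefs * coefs) :=
  is_argmin (dual_fun (@grid_measure R d N) nu lambda c m) (grid_feasible N).

End Problem.

(* Main.v *)
Require Import Defs.
From mathcomp Require Import all_boot all_order all_algebra finmap.
From mathcomp Require Import all_classical all_reals all_analysis.
From mathcomp Require Import measurable_realfun complex ring lra.

(** The proof is a perturbation argument around the continuous minimizer
    [x0 = (phat, qhat)], and rests on convexity.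

    The point [x0] is interior. A finite value of the dual function makes
    [1 / P^(nu-1)] integrable. At a zero a nonnegative trigonometric polynomial
    vanishes to order two ([poly_val_translate_le]), so [1 / P^(nu-1)] grows at
    least like the power [-2 (nu - 1)] of the distance, and [2 (nu - 1) >= d]
    forbids integrability. In quantitative form
    ([inve_integrable_lower_bound]) this bounds [P] below, and then [Q]
    ([dual_solution_above]).

    On a small cube around [x0] all polynomials are therefore bounded below, the
    integrands are uniformly Lipschitz, and the Riemann sums converge uniformly:
    the discrete objective [J N] is uniformly close to the continuous one
    ([objective_dist]).

    The discrete objectives are convex, because [a^nu / c^(nu-1)] is a
    perspective function, and on the cube they are strongly convex with a
    modulus that does not depend on the grid: the pointwise gap at a midpoint
    dominates the squares of the differences of [P] and of [Q]
    ([density_midpoint]), and on a fine grid the mean of such a square is the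
    sum of the squares of the coefficients ([parseval], [objective_midpoint]).

    Suppose that a feasible point [y] at distance at least [rho] from [x0] has
    [J N y <= J N x0]. On the segment from [x0] to [y] there is a point [z] at
    distance [rho], and [J N z <= J N x0] too. Strong convexity puts the value
    of [J N] at the midpoint of [x0] and [z] below [J N x0] by a fixed amount,
    while [x0] minimizes an objective uniformly close to [J N]. This is absurd
    for fine grids ([sublevel_near]). So the discrete minimizers lie within
    [rho] of [x0] as soon as the grid is fine enough, which gives boundedness
    and convergence; compactness of the cube gives their existence and strong
    convexity their uniqueness ([unique_solution]). *)

Set Implicit Arguments.
Unset Strict Implicit.
Unset Printing Implicit Defensive.

Import Order.TTheory GRing.Theory Num.Theory.
Import numFieldNormedType.Exports.

Local Open Scope classical_set_scope.
Local Open Scope ring_scope.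

(** * Elementary trigonometry and trigonometric polynomials *)

Section Trigonometry.
Variable R : realType.
Implicit Types x y : R.

Lemma cos_sub_le x y : `|cos x - cos y| <= `|x - y|.
Proof.
wlog xy : x y / y <= x.
  move=> h; have [/h//|/ltW/h] := leP y x.
  by rewrite distrC [X in _ <= X]distrC.
have [c _ ->] := @MVT_segment R cos (- sin) y x xy
  (fun z _ => is_derive_cos z) (continuous_subspaceT (@continuous_cos R)).
rewrite normrM ler_piMl// normrN ler_norml sin_le1 andbT.
exact: sin_geN1.
Qed.

Lemma sin_norm_le x : `|sin x| <= `|x|.
Proof.
rewrite -[x in sin x](subrK (pi / 2)) sinDpihalf.
have := cos_sub_le (x - pi / 2) (- (pi / 2)).
by rewrite cosN cos_pihalf subr0 opprK subrK.
Qed.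

Lemma one_sub_cosE x : 1 - cos x = 2 * sin (x / 2) ^+ 2.
Proof.
have := cosD (x / 2) (x / 2); rewrite -splitr => ->.
have := cos2Dsin2 (x / 2).
lra.
Qed.

Lemma one_sub_cos_le x : 1 - cos x <= x ^+ 2.
Proof.
rewrite one_sub_cosE.
have : `|sin (x / 2)| ^+ 2 <= `|x / 2| ^+ 2.
  by rewrite lerXn2r ?nnegrE// sin_norm_le.
rewrite !real_normK ?num_real//.
have := sqr_ge0 x.
rewrite exprMn; lra.
Qed.

Lemma cosD2npi (x : R) (n : int) : cos (x + 2 * pi * n%:~R) = cos x.
Proof.
have E (m : nat) y : cos (y + 2 * pi * m%:R) = cos y.
  rewrite -[RHS](periodicn (@cosD2pi R) m); congr (cos (_ + _)).
  by rewrite mulr_natr [2 * _]mulr_natl.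
case: n => m; first exact: E.
by rewrite NegzE mulrNz mulrN -[LHS](E m.+1) subrK.
Qed.

Lemma sinD2npi (x : R) (n : int) : sin (x + 2 * pi * n%:~R) = sin x.
Proof.
have E y : sin y = cos (y - pi / 2) by rewrite cosBpihalf.
by rewrite !E addrAC cosD2npi.
Qed.

Lemma cos_lt1 x : 0 < x < 2 * pi -> cos x < 1.
Proof.
move=> /andP[x0 x2]; rewrite -subr_gt0 one_sub_cosE mulr_gt0// exprn_gt0//.
by apply: sin_gt0_pi; apply/andP; split; lra.
Qed.

End Trigonometry.

Section TrigPoly.
Variables (R : realType) (d : nat) (L : {fset 'rV[int]_d}).
Implicit Types (p q : coefs R L) (t s : d.-tuple R) (h : 'I_d -> R).

Definition translate t h : d.-tuple R := [tuple tnth t j + h j | j < d].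

Definition freq_bound : nat :=
  \max_(k : L) \max_(j < d) absz ((val k : 'rV[int]_d) ord0 j).

Definition coef_sum p : R := \sum_(k : L) `|p k|.

Lemma freq_boundP (k : L) j :
  (absz ((val k : 'rV[int]_d) ord0 j) <= freq_bound)%N.
Proof.
apply: leq_trans (leq_bigmax_cond k erefl).
exact: (leq_bigmax_cond j erefl).
Qed.

Lemma normr_intr_absz (z : int) : `|z%:~R : R| = (absz z)%:R.
Proof. by rewrite -intr_norm -abszE. Qed.

Lemma pairing_le (k : L) t s : `|pairing (val k) t - pairing (val k) s| <=
  freq_bound%:R * \sum_(j < d) `|tnth t j - tnth s j|.
Proof.
rewrite /pairing -sumrB mulr_sumr (le_trans (ler_norm_sum _ _ _))//.
apply: ler_sum => j _; rewrite -mulrBr normrM ler_wpM2r//.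
by rewrite normr_intr_absz ler_nat freq_boundP.
Qed.

Lemma pairing_translate (k : 'rV[int]_d) t h : pairing k (translate t h) =
  pairing k t + \sum_(j < d) (k ord0 j)%:~R * h j.
Proof.
rewrite /pairing -big_split/=; apply: eq_bigr => j _.
by rewrite tnth_mktuple mulrDr.
Qed.

Lemma poly_valE p t :
  poly_val p t = \sum_(k : L) p k * cos (pairing (val k) t).
Proof.
rewrite /poly_val /trig_poly raddf_sum; apply: eq_bigr => k _ /=.
by rewrite cosN mul0r subr0.
Qed.

Lemma coef_sum_ge0 p : 0 <= coef_sum p.
Proof. exact: sumr_ge0. Qed.

Lemma normr_cos_le1 (x : R) : `|cos x| <= 1.
Proof. by rewrite ler_norml cos_geN1 cos_le1. Qed.

Lemma poly_val_norm_le p t : `|poly_val p t| <= coef_sum p.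
Proof.
rewrite poly_valE (le_trans (ler_norm_sum _ _ _))//; apply: ler_sum => k _.
by rewrite normrM ler_piMr// normr_cos_le1.
Qed.

Lemma poly_val_lip p t s : `|poly_val p t - poly_val p s| <=
  coef_sum p * (freq_bound%:R * \sum_(j < d) `|tnth t j - tnth s j|).
Proof.
rewrite !poly_valE -sumrB (le_trans (ler_norm_sum _ _ _))// mulr_suml.
apply: ler_sum => k _; rewrite -mulrBr normrM ler_wpM2l//.
exact: le_trans (cos_sub_le _ _) (pairing_le _ _ _).
Qed.

(** The second difference of a cosine at [t] along [h] is
    [2 cos <k,t> (cos <k,h> - 1)]; where the polynomial is nonnegative this
    bounds its growth quadratically, without derivatives. *)
Lemma poly_val_translate_le p t h (e : R) :
  0 <= e ->
  (forall s, 0 <= poly_val p s) -> (forall j, `|h j| <= e) ->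
  poly_val p (translate t h) <=
    2 * poly_val p t + 2 * coef_sum p * (freq_bound%:R * (d%:R * e)) ^+ 2.
Proof.
move=> e0 p0 he; pose h' j := - h j.
apply: (@le_trans _ _ (poly_val p (translate t h) + poly_val p (translate t h'))).
  by rewrite lerDl.
rewrite !poly_valE -big_split/= -lerBlDl !mulr_sumr mulr_suml -sumrB.
apply: ler_sum => k _.
rewrite !pairing_translate; set y := \sum_j _; set z := \sum_j _.
have -> : z = - y.
  by rewrite /z /y -sumrN; apply: eq_bigr => j _; rewrite mulrN.
set x := pairing _ _; rewrite cosB cosD.
have -> : p k * (cos x * cos y - sin x * sin y) +
   p k * (cos x * cos y + sin x * sin y) - 2 * (p k * cos x) =
   2 * (- (p k * cos x) * (1 - cos y)) by ring.
rewrite -mulrA ler_wpM2l//.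
have c0 : 0 <= 1 - cos y by rewrite subr_ge0 cos_le1.
apply: (@le_trans _ _ (`|p k| * (1 - cos y))).
  rewrite ler_wpM2r// (le_trans (ler_norm _))// normrN normrM ler_piMr//.
  exact: normr_cos_le1.
rewrite ler_wpM2l// (le_trans (one_sub_cos_le _))//.
rewrite -[y ^+ 2]real_normK ?num_real// lerXn2r ?nnegrE//.
  by rewrite !mulr_ge0.
rewrite (le_trans (ler_norm_sum _ _ _))//.
have -> : freq_bound%:R * (d%:R * e) = \sum_(j < d) freq_bound%:R * e.
  by rewrite sumr_const card_ord -[RHS]mulr_natl mulrCA.
apply: ler_sum => j _; rewrite normrM ler_pM//.
by rewrite normr_intr_absz ler_nat freq_boundP.
Qed.

Lemma poly_val_periodic p t : exists2 s, torus s & poly_val p t = poly_val p s.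
Proof.
pose n j := Num.floor (tnth t j / (2 * pi)).
pose h j := - (2 * pi * (n j)%:~R : R).
have pi0 := pi2_gt0 R.
exists (translate t h).
  move=> j; rewrite tnth_mktuple /h subr_ge0 ltrBlDr.
  have tE : tnth t j = 2 * pi * (tnth t j / (2 * pi)).
    by rewrite mulrC divfK// gt_eqF.
  have -> : 2 * pi + 2 * pi * (n j)%:~R = 2 * pi * (n j + 1)%:~R :> R.
    by ring.
  by apply/andP; split; rewrite tE ?ler_pM2l ?ltr_pM2l ?floor_le ?floorD1_gt.
rewrite !poly_valE; apply: eq_bigr => k _; rewrite pairing_translate.
have -> : \sum_(j < d) ((val k : 'rV[int]_d) ord0 j)%:~R * h j =
   2 * pi * (- \sum_(j < d) (val k : 'rV[int]_d) ord0 j * n j)%:~R.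
  rewrite mulrNz raddf_sum /= mulrN mulr_sumr -sumrN; apply: eq_bigr => j _.
  by rewrite /h mulrN intrM; congr (- _); ring.
by rewrite cosD2npi.
Qed.

End TrigPoly.

(** * Lebesgue measure of boxes and Riemann sums *)

Section TorusMeasure.
Variable R : realType.
Local Notation mu := (torus_measure R).

Definition box d (A : 'I_d -> set R) : set (d.-tuple R) :=
  [set t | forall j, A j (tnth t j)].

Lemma measurable_box d (A : 'I_d -> set R) :
  (forall j, measurable (A j)) -> measurable (box A).
Proof.
move=> mA.
have -> : box A = \bigcap_(j in [set: 'I_d]) ((@tnth _ R ^~ j) @^-1` A j).
  by apply/seteqP; split => [t At j _|t At j]; [exact: At|exact: (At j I)].
apply: fin_bigcap_measurable => // j _.
by rewrite -[_ @^-1` _]setTI; exact: measurable_tnth.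
Qed.

Lemma torus_measure_box d (A : 'I_d -> set R) (a : 'I_d -> R) :
  (forall j, measurable (A j)) ->
  (forall j, circle_measure R (A j) = (a j)%:E) ->
  mu d (box A) = (\prod_(j < d) a j)%:E.
Proof.
elim: d => [|d IH] in A a * => mA Aa.
  by rewrite big_ord0 /= diracE mem_set// => -[].
rewrite big_ord_recl EFinM /= /pushforward.
have -> : @tuple_cons R d @^-1` box A =
    A ord0 `*` box (fun j => A (lift ord0 j)).
  apply/seteqP; split => [[x t] /= At|[x t] /= [Ax At] j].
    by split; [have := At ord0; rewrite tnth0|move=> j;
      have := At (lift ord0 j); rewrite tnthS].
  by case: (unliftP ord0 j) => [i ->|->]; rewrite ?tnthS ?tnth0//; exact: At.
rewrite product_measure1E; [|exact: (mA ord0)|exact: measurable_box].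
by rewrite -Aa -(IH (fun j => A (lift ord0 j))).
Qed.

Lemma circle_measure_itv (a b : R) : 0 <= a -> a <= b -> b <= 2 * pi ->
  circle_measure R `[a, b[%classic = ((b - a) / (2 * pi))%:E.
Proof.
move=> a0 ab b2; rewrite /circle_measure /= /uniform_prob.
rewrite (eq_integral (fun=> (2 * pi)^-1%:E)); last first.
  move=> x; rewrite inE/= in_itv/= /uniform_pdf => /andP[ax xb].
  by rewrite subr0 (le_trans a0 ax) (le_trans (ltW xb) b2).
rewrite integral_cst//=.
have := lebesgue_measure_itv `[a, b[%R; rewrite /= lte_fin => ->.
have [_|ba] := ltP a b; first by rewrite -EFinD -EFinM mulrC.
by rewrite mule0 (le_anti (introT andP (conj ab ba))) subrr mul0r.
Qed.

Lemma torus_box d : @torus R d = box (fun=> `[0, 2 * pi[%classic).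
Proof.
by apply/seteqP; split => t tt j; have := tt j; rewrite /= in_itv.
Qed.

Lemma measurable_torus d : measurable (@torus R d).
Proof. by rewrite torus_box; apply: measurable_box. Qed.

Lemma torus_measureT d : mu d (@torus R d) = 1%:E.
Proof.
rewrite torus_box (@torus_measure_box _ _ (fun=> 1))//; first by rewrite big1.
move=> j; rewrite circle_measure_itv//; last by rewrite ltW// pi2_gt0.
by rewrite subr0 divff// gt_eqF// pi2_gt0.
Qed.

End TorusMeasure.
#[global] Hint Extern 0 (measurable torus) =>
  solve [apply: measurable_torus] : core.

Section RiemannSum.
Variables (R : realType) (d : nat).
Local Notation mu := (torus_measure R d).
Implicit Types (f : d.-tuple R -> R) (t s : d.-tuple R) (N : 'I_d -> nat).

Definition grid_mean N f : R :=
  (\prod_(j < d) N j)%N%:R^-1 * \sum_(l : grid_index N) f (grid_point R l).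

Definition torus_mean f : R := \int[mu]_(t in torus) f t.

Definition cell N (l : grid_index N) : set (d.-tuple R) :=
  box (fun j => `[2 * pi / (N j)%:R * (l j)%:R,
                  2 * pi / (N j)%:R * (l j).+1%:R[%classic).

Lemma measurable_cell N (l : grid_index N) : measurable (cell l).
Proof. exact: measurable_box. Qed.

Lemma grid_point_torus N (l : grid_index N) : torus (grid_point R l).
Proof.
move=> j; rewrite tnth_mktuple.
have N0 : (0 < N j)%N by apply: leq_ltn_trans (ltn_ord (l j)).
have pi0 := pi2_gt0 R.
rewrite mulr_ge0 ?divr_ge0 ?(ltW pi0)//= mulrAC ltr_pdivrMr ?ltr0n//.
by rewrite ltr_pM2l// ltr_nat ltn_ord.
Qed.

Lemma cell_measure N (l : grid_index N) : (forall j, 0 < N j)%N ->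
  mu (cell l) = (\prod_(j < d) N j)%N%:R^-1%:E.
Proof.
move=> N0; rewrite (@torus_measure_box _ _ _ (fun j => (N j)%:R^-1))//.
  by rewrite prodfV natr_prod.
move=> j; have pi0 := pi2_gt0 R; have Nj : 0 < (N j)%:R :> R by rewrite ltr0n.
have c0 : 0 <= 2 * pi / (N j)%:R :> R by rewrite divr_ge0// ltW.
rewrite circle_measure_itv.
- rewrite -mulrBr -[(l j).+1%:R]natr1 addrAC subrr add0r.
  by rewrite mulr1 mulrAC divff ?gt_eqF// mul1r.
- by rewrite mulr_ge0.
- by rewrite ler_wpM2l// ler_nat.
- rewrite mulrAC ler_pdivrMr// ler_wpM2l ?(ltW pi0)//.
  by rewrite ler_nat ltn_ord.
Qed.

Lemma cell_torus N (l : grid_index N) : cell l `<=` torus.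
Proof.
move=> t lt j; have := lt j; rewrite /= in_itv/= => /andP[h1 h2].
have N0 : (0 < N j)%N by apply: leq_ltn_trans (ltn_ord (l j)).
have pi0 := pi2_gt0 R; have Nj : 0 < (N j)%:R :> R by rewrite ltr0n.
have c0 : 0 <= 2 * pi / (N j)%:R :> R by rewrite divr_ge0// ltW.
apply/andP; split; first by apply: le_trans h1; rewrite mulr_ge0 ?ler0n.
apply: lt_le_trans h2 _.
by rewrite mulrAC ler_pdivrMr// ler_wpM2l ?(ltW pi0)// ler_nat ltn_ord.
Qed.

Lemma torus_cell N t : (forall j, 0 < N j)%N -> torus t ->
  exists l : grid_index N, cell l t.
Proof.
move=> N0 tt; pose n j := Num.truncn (tnth t j / (2 * pi / (N j)%:R)).
have pi0 := pi2_gt0 R.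
have Nj j : 0 < (N j)%:R :> R by rewrite ltr0n.
have c0 j : 0 < 2 * pi / (N j)%:R :> R by rewrite divr_gt0.
have nP j : (n j)%:R <= tnth t j / (2 * pi / (N j)%:R) < (n j).+1%:R.
  by apply: truncn_itv; rewrite divr_ge0 ?(ltW (c0 j))//; case/andP: (tt j).
have nN j : (n j < N j)%N.
  rewrite -(ltr_nat R); case/andP: (nP j) => h _; apply: le_lt_trans h _.
  rewrite ltr_pdivrMr// mulrC divfK ?gt_eqF//.
  by case/andP: (tt j).
exists [ffun j => Ordinal (nN j)] => j; rewrite /= in_itv/= ffunE/=.
case/andP: (nP j); rewrite ler_pdivlMr// ltr_pdivrMr// => h1 h2.
by rewrite ![_ / _ * _]mulrC h1 h2.
Qed.

Lemma cell_inj N (l l' : grid_index N) t : cell l t -> cell l' t -> l = l'.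
Proof.
move=> lt lt'; apply/ffunP => j; apply/val_inj/eqP.
have := lt j; have := lt' j; rewrite /= !in_itv/= => /andP[a b] /andP[a' b'].
have N0 : (0 < N j)%N by apply: leq_ltn_trans (ltn_ord (l j)).
have c0 : 0 < 2 * pi / (N j)%:R :> R by rewrite divr_gt0 ?pi2_gt0// ltr0n.
have := le_lt_trans a' b; rewrite ltr_pM2l// ltr_nat ltnS => h1.
have := le_lt_trans a b'; rewrite ltr_pM2l// ltr_nat ltnS => h2.
by rewrite eqn_leq h1 h2.
Qed.

(** The step function constant on cells whose mean is the grid mean of [f];
    comparing [f] with it turns the Riemann sum error into a supremum bound. *)
Definition cell_step N f t : R :=
  \sum_(l : grid_index N) f (grid_point R l) * \1_(cell l) t.

Lemma cell_stepE N f (l : grid_index N) t : cell l t ->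
  cell_step N f t = f (grid_point R l).
Proof.
move=> lt; rewrite /cell_step (bigD1 l)//= indicE mem_set// mulr1.
rewrite big1 ?addr0// => k kl; rewrite indicE memNset ?mulr0// => kt.
by move/eqP: kl; apply; exact: cell_inj kt lt.
Qed.

Lemma cell_step_dist N f (C : R) t : (forall j, 0 < N j)%N ->
  (forall t s, torus t -> torus s ->
    `|f t - f s| <= C * \sum_(j < d) `|tnth t j - tnth s j|) -> 0 <= C ->
  torus t -> `|f t - cell_step N f t| <= C * \sum_(j < d) (2 * pi / (N j)%:R).
Proof.
move=> N0 lf C0 tt; have [l lt] := torus_cell N0 tt.
rewrite (cell_stepE _ lt) (le_trans (lf _ _ tt (grid_point_torus l)))//.
rewrite ler_wpM2l//; apply: ler_sum => j _; rewrite tnth_mktuple.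
have := lt j; rewrite /= in_itv/= => /andP[h1 h2].
rewrite ger0_norm ?subr_ge0//; move: h2; rewrite -[(l j).+1%:R]natr1 mulrDr mulr1; lra.
Qed.

Lemma integrable_cell_step N f :
  mu.-integrable torus (EFin \o cell_step N f).
Proof.
have -> : EFin \o cell_step N f = (fun t => \sum_(l : grid_index N)
    (f (grid_point R l))%:E * (\1_(cell l) t)%:E)%E.
  by apply/funext => t /=; rewrite -sumEFin.
apply: integrable_sum => // l _; apply: integrableZl => //.
apply: integrableS (integrable_indic _ _) => //.
exact: measurable_cell.
Qed.

Lemma torus_mean_cell_step N f : (forall j, 0 < N j)%N ->
  torus_mean (cell_step N f) = grid_mean N f.
Proof.
move=> N0; rewrite /torus_mean /Rintegral.
rewrite (eq_integral (fun t => \sum_(l : grid_index N)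
    (f (grid_point R l))%:E * (\1_(cell l) t)%:E)%E); last first.
  by move=> t _; rewrite -sumEFin.
have i1 (l : grid_index N) : mu.-integrable torus (fun t => (\1_(cell l) t)%:E).
  apply: integrableS (integrable_indic _ _) => //.
  exact: measurable_cell.
rewrite integral_sum//; last by move=> l; apply: integrableZl.
rewrite (eq_bigr (fun l : grid_index N =>
    (f (grid_point R l) * (\prod_(j < d) N j)%N%:R^-1)%:E)).
  by rewrite sumEFin/= /grid_mean mulr_sumr; apply: eq_bigr => l _; rewrite mulrC.
move=> l _; rewrite integralZl// integral_indic//; last exact: measurable_cell.
rewrite setIidl; last exact: cell_torus.
by rewrite EFinM; congr (_ * _)%E; exact: cell_measure.
Qed.

Lemma riemann_sum_dist N f (C : R) : (forall j, 0 < N j)%N ->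
  mu.-integrable torus (EFin \o f) -> 0 <= C ->
  (forall t s, torus t -> torus s ->
    `|f t - f s| <= C * \sum_(j < d) `|tnth t j - tnth s j|) ->
  `|torus_mean f - grid_mean N f| <= C * \sum_(j < d) (2 * pi / (N j)%:R).
Proof.
move=> N0 fi C0 lf; rewrite -torus_mean_cell_step// /torus_mean.
have si := integrable_cell_step N f.
rewrite -RintegralB//; set K := C * _.
have di : mu.-integrable torus (EFin \o (fun t => f t - cell_step N f t)).
  exact: (integrableB _ fi si).
apply: le_trans (le_normr_Rintegral _ di) _ => //.
have -> : K = \int[mu]_(t in torus) K.
  by rewrite Rintegral_cst// [X in fine X]torus_measureT mulr1.
apply: le_Rintegral => //.
- exact: integrable_norm.
- exact: finite_measure_integrable_cst.
- by move=> t tt; exact: cell_step_dist.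
Qed.

End RiemannSum.

(** * Nonintegrability at a zero *)

Section Measurability.
Variable R : realType.

(** Inversion is continuous off [0], where its value is a convention. *)
Lemma measurable_invr : measurable_fun [set: R] (@GRing.inv R).
Proof.
have D0 : open [set x : R | x != 0] by exact: open_neq.
have -> : @GRing.inv R = fun x => if x == 0 then 0 else x^-1.
  by apply/funext => x; case: eqVneq => // ->; rewrite invr0.
apply: measurable_fun_if => //.
- exact: measurable_fun_eqr.
- rewrite setTI; have -> : eq_op^~ 0 @^-1` [set false] = [set x : R | x != 0].
    by apply/seteqP; split => x /=; [move=> ->|move/negbTE].
  apply: open_continuous_measurable_fun => // x; rewrite inE/=.
  exact: inv_continuous.
Qed.

Variables (d : nat) (L : {fset 'rV[int]_d}).
Local Notation mu := (torus_measure R d).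

Lemma measurable_poly_val (p : coefs R L) :
  measurable_fun [set: d.-tuple R] (poly_val p).
Proof.
rewrite (funext (poly_valE p)); apply: measurable_sum => k.
apply: measurable_funM => //.
apply: (measurableT_comp (continuous_measurable_fun (@continuous_cos R))).
apply: measurable_sum => j; apply: measurable_funM => //.
exact: measurable_tnth.
Qed.

Lemma measurable_inv_poly_val (p : coefs R L) n :
  measurable_fun [set: d.-tuple R] (fun t => (poly_val p t ^+ n)^-1).
Proof.
apply: (measurableT_comp measurable_invr).
by apply: measurable_funX; exact: measurable_poly_val.
Qed.

Lemma measurable_inve_poly_val (p : coefs R L) n :
  measurable_fun [set: d.-tuple R] (fun t => ((poly_val p t ^+ n)%:E)^-1%E).
Proof.
have mP := measurable_funX n (measurable_poly_val p).
under eq_fun do rewrite inver.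
apply: measurable_fun_ifT => //; first exact: measurable_fun_eqr.
by apply/measurable_EFinP; exact: measurable_inv_poly_val.
Qed.

End Measurability.

Section NonIntegrability.
Variables (R : realType) (d : nat) (L : {fset 'rV[int]_d}).
Local Notation mu := (torus_measure R d).
Variables (p : coefs R L) (n : nat).
Hypothesis d_gt0 : (0 < d)%N.
Hypothesis dn : (d <= n.*2)%N.
Hypothesis p_ge0 : forall t, torus t -> 0 <= poly_val p t.
Hypothesis p_int :
  (\int[mu]_(t in torus) ((poly_val p t ^+ n)%:E)^-1 < +oo)%E.

Let n_gt0 : (0 < n)%N.
Proof. by case: n dn => //; rewrite leqNgt d_gt0. Qed.

Let zeros : set (d.-tuple R) := torus `&` [set t | poly_val p t = 0].

Let measurable_zeros : measurable zeros.
Proof.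
apply: measurableI => //.
have -> : [set t | poly_val p t = 0] = poly_val p @^-1` [set 0] by [].
by rewrite -[_ @^-1` _]setTI; apply: measurable_poly_val.
Qed.

Let integrand_ge0 t : torus t -> (0 <= ((poly_val p t ^+ n)%:E)^-1)%E.
Proof. by move=> tt; rewrite inve_ge0 lee_fin exprn_ge0// p_ge0. Qed.

(* The extended inverse is infinite on the zeros, and its integral is finite. *)
Let zeros_null : mu zeros = 0%E.
Proof.
apply/eqP; rewrite -measure_le0 leNgt; apply/negP => Z0.
move: p_int; rewrite ltNge => /negP; apply.
apply: (@le_trans _ _ (\int[mu]_(t in zeros) ((poly_val p t ^+ n)%:E)^-1)%E).
  rewrite (eq_integral (cst +oo%E)); last first.
    by move=> t /[!inE] -[_ /= ->]; rewrite expr0n gtn_eqF// inve0.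
  by rewrite integral_cst// gt0_mulye.
apply: ge0_subset_integral => //; last by move=> t [].
by apply: measurable_funTS; exact: measurable_inve_poly_val.
Qed.

Let f t : R := (poly_val p t ^+ n)^-1.

Let f_int : mu.-integrable setT (EFin \o (f \_ torus)).
Proof.
suff h : mu.-integrable torus (EFin \o f).
  have := (integrable_mkcond _ (@measurable_torus R d)).1 h.
  by rewrite restrict_EFin.
apply/integrableP; split.
  apply/measurable_EFinP; apply: measurable_funTS.
  exact: measurable_inv_poly_val.
apply: le_lt_trans p_int; apply: ge0_le_integral => //=.
- apply: measurable_funTS; apply/measurable_EFinP/measurableT_comp => //.
  exact: measurable_inv_poly_val.
- by apply: measurable_funTS; exact: measurable_inve_poly_val.
- move=> t tt; rewrite inver; case: ifPn => _; first exact: leey.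
  by rewrite lee_fin ger0_norm// invr_ge0 exprn_ge0// p_ge0.
Qed.

Let all_ge0 t : 0 <= poly_val p t.
Proof. by have [s ss ->] := poly_val_periodic p t; exact: p_ge0. Qed.

(** A half-open cube of side [s] with a vertex at [t0]: in each coordinate it
    extends to the side on which it does not leave the torus. *)
Definition corner (t0 : d.-tuple R) (s : R) : set (d.-tuple R) :=
  box (fun j => if tnth t0 j + s <= 2 * pi
    then `[tnth t0 j, tnth t0 j + s[%classic
    else `[tnth t0 j - s, tnth t0 j[%classic).

Lemma measurable_corner (t0 : d.-tuple R) s : measurable (corner t0 s).
Proof. by apply: measurable_box => j; case: ifP. Qed.

Lemma corner_measure (t0 : d.-tuple R) s : torus t0 -> 0 < s <= 1 ->
  mu (corner t0 s) = ((s / (2 * pi)) ^+ d)%:E.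
Proof.
move=> tt /andP[s0 s1]; have p2 := pi_ge2 R.
rewrite (@torus_measure_box _ _ _ (fun=> s / (2 * pi))).
- by rewrite prodr_const card_ord.
- by move=> j; case: ifP.
move=> j; have /andP[tj0 tj2] := tt j; case: ifPn => [h|].
  by rewrite circle_measure_itv ?lerDl ?(ltW s0)// addrAC subrr add0r.
rewrite -ltNge => h; rewrite circle_measure_itv ?gerBl ?(ltW s0) ?(ltW tj2)//.
  by rewrite opprB addrC addrNK.
lra.
Qed.

Lemma corner_torus (t0 : d.-tuple R) s : torus t0 -> 0 < s <= 1 ->
  corner t0 s `<=` torus.
Proof.
move=> tt /andP[s0 s1] t ct j; have p2 := pi_ge2 R.
have /andP[tj0 tj2] := tt j; have := ct j; rewrite /=.
case: ifPn => [h|]; first by rewrite /= in_itv/= => /andP[a b]; lra.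
by rewrite -ltNge => h; rewrite /= in_itv/= => /andP[a b]; lra.
Qed.

Lemma corner_translate (t0 t : d.-tuple R) s : corner t0 s t ->
  exists2 h, t = translate t0 h & forall j : 'I_d, `|h j| <= s.
Proof.
move=> ct; exists (fun j => tnth t j - tnth t0 j).
  by apply: eq_from_tnth => j; rewrite tnth_mktuple addrC subrK.
move=> j; have := ct j; rewrite /=; case: ifP => _;
  rewrite /= in_itv/= ler_norml => /andP[a b]; lra.
Qed.

(** If a value [P(t0) <= s^2] occurs, then [P = O(s^2)] on a cube of side [s]
    at [t0], on which [P^-n] has an integral of order at least
    [s^(d - 2n) >= 1]. For small [s] absolute continuity of the integral of
    [P^-n] forbids this, so [P] is bounded below. *)
Lemma inve_integrable_lower_bound :
  exists2 delta : R, 0 < delta & forall t, delta <= poly_val p t.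
Proof.
(* On the cube of side [s], [P <= K s^2] as soon as [P(t0) <= s^2]. *)
pose K : R := 2 + 2 * coef_sum p * (freq_bound L)%:R ^+ 2 * d%:R ^+ 2.
have pi0 := pi2_gt0 R; have p2 := pi_ge2 R.
have K0 : 0 < K by rewrite ltr_pwDl// !mulr_ge0 ?coef_sum_ge0 ?exprn_ge0.
pose e : R := K^-1 ^+ n * (2 * pi)^-1 ^+ d.
have e0 : 0 < e by rewrite mulr_gt0// exprn_gt0// invr_gt0.
have [r [r0 hr]] := integral_normr_continuous f_int e0.
pose s : R := Num.min 1 r.
have s0 : 0 < s by rewrite lt_min ltr01.
have s1 : s <= 1 by rewrite ge_min lexx.
have sr : s <= r by rewrite ge_min lexx orbT.
have s01 : 0 < s <= 1 by rewrite s0.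
have hs2 : s / (2 * pi) < s by rewrite ltr_pdivrMr// ltr_pMr//; lra.
have q0 : 0 < s / (2 * pi) by rewrite divr_gt0.
exists (s ^+ 2); first exact: exprn_gt0.
suff h t : torus t -> s ^+ 2 <= poly_val p t.
  by move=> t; have [u uu ->] := poly_val_periodic p t; exact: h.
move=> tt; rewrite leNgt; apply/negP => ts.
(* Real inversion sends [0] to [0], so the lower bound on [f] needs the zeros
   removed. *)
pose B := corner t s `\` zeros.
have mC : measurable (corner t s) by exact: measurable_corner.
have mB : measurable B by exact: measurableD.
have muB : mu B = ((s / (2 * pi)) ^+ d)%:E.
  rewrite -(corner_measure tt s01) [RHS](measureDI _ mC measurable_zeros).
  rewrite [X in (_ + X)%E](subset_measure0 _ _ _ zeros_null) ?adde0//.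
  exact: measurableI.
have BT : B `<=` torus by move=> u [uc _]; exact: corner_torus uc.
have muBr : (mu B < r%:E)%E.
  rewrite muB lte_fin (le_lt_trans _ (lt_le_trans hs2 sr))//.
  rewrite -[leRHS]expr1 ler_wiXn2l//; [exact: ltW|lra].
have := hr _ mB muBr; rewrite ltNge => /negP; apply.
pose c : R := ((K * s ^+ 2) ^+ n)^-1.
apply: (@le_trans _ _ (\int[mu]_(u in B) c)).
  rewrite Rintegral_cst// [X in fine X]muB/=.
  have -> : c * (s / (2 * pi)) ^+ d = e * (((s ^+ 2) ^+ n)^-1 * s ^+ d).
    rewrite /c /e; move: (2 * pi)^-1 => q.
    rewrite [in LHS]exprMn invfM [(s * q) ^+ d]exprMn exprVn.
    by move: (_ ^- n) (_ ^- n) (s ^+ d) (q ^+ d) => a b x y; ring.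
  rewrite ler_peMr ?(ltW e0)//.
  rewrite mulrC ler_pdivlMr ?exprn_gt0// mul1r -exprM mul2n.
  by rewrite ler_wiXn2l// ltW.
apply: le_Rintegral => //.
- exact: finite_measure_integrable_cst.
- apply: (integrableS measurableT mB (@subsetT _ _)).
  exact: (integrable_norm f_int).
move=> u Bu; have uu := BT _ Bu; have [uc uz] := Bu.
rewrite patchE mem_set// ger0_norm; last first.
  by rewrite invr_ge0 exprn_ge0.
rewrite /c /f; have u0 : 0 < poly_val p u.
  by rewrite lt_neqAle all_ge0 andbT eq_sym; apply/eqP => z; apply: uz.
rewrite lef_pV2 ?posrE ?exprn_gt0 ?mulr_gt0 ?exprn_gt0//.
rewrite lerXn2r ?nnegrE ?mulr_ge0 ?exprn_ge0 ?(ltW K0) ?(ltW s0)//.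
have [h -> hh] := corner_translate uc.
apply: (le_trans (poly_val_translate_le _ (ltW s0) all_ge0 hh)).
rewrite [X in _ <= X](_ : _ = 2 * s ^+ 2 +
  2 * coef_sum p * ((freq_bound L)%:R * (d%:R * s)) ^+ 2); last by rewrite /K; ring.
by rewrite lerD2r ler_wpM2l// ltW.
Qed.

End NonIntegrability.

(** * Convexity of the integrand *)

Section Density.
Variable R : realType.
Implicit Types a b c e r s u v : R.

(** Bernoulli's inequality, homogenized so that it makes sense at [r = 0]. The
    remainder is [s] times the previous one plus a multiple of [(s - r)^2]. *)
Lemma bernoulli_gap_ge0 n s r : 0 <= s -> 0 <= r ->
  0 <= s ^+ n.+1 + n%:R * r ^+ n.+1 - n.+1%:R * r ^+ n * s.
Proof.
move=> s0 r0; elim: n => [|n IH].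
  by rewrite mul0r addr0 expr0 expr1 !mul1r subrr.
have -> : s ^+ n.+2 + n.+1%:R * r ^+ n.+2 - n.+2%:R * r ^+ n.+1 * s =
    s * (s ^+ n.+1 + n%:R * r ^+ n.+1 - n.+1%:R * r ^+ n * s) +
    n.+1%:R * r ^+ n * (s - r) ^+ 2.
  by rewrite -[n.+2%:R]natr1 -[n.+1%:R]natr1 !exprS; ring.
apply: addr_ge0; first exact: mulr_ge0.
by rewrite mulr_ge0 ?sqr_ge0// mulr_ge0// exprn_ge0.
Qed.

(** The last step of the same recursion keeps the square, which quantifies
    strict convexity. *)
Lemma bernoulli_gap_ge n s r : 0 <= s -> 0 <= r ->
  n.+1%:R * r ^+ n * (s - r) ^+ 2 <=
  s ^+ n.+2 + n.+1%:R * r ^+ n.+2 - n.+2%:R * r ^+ n.+1 * s.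
Proof.
move=> s0 r0.
have -> : s ^+ n.+2 + n.+1%:R * r ^+ n.+2 - n.+2%:R * r ^+ n.+1 * s =
    s * (s ^+ n.+1 + n%:R * r ^+ n.+1 - n.+1%:R * r ^+ n * s) +
    n.+1%:R * r ^+ n * (s - r) ^+ 2.
  by rewrite -[n.+2%:R]natr1 -[n.+1%:R]natr1 !exprS; ring.
by rewrite lerDr mulr_ge0// bernoulli_gap_ge0.
Qed.

(** The perspective function of [s |-> s^(n+1)], hence jointly convex. Both
    integrands are instances, since [1 / p^n] is [perspective n 1 p]. *)
Definition perspective n a c : R := a ^+ n.+1 / c ^+ n.

Lemma perspectiveE n a c : 0 < c -> perspective n a c = c * (a / c) ^+ n.+1.
Proof.
move=> c0; rewrite /perspective expr_div_n [c ^+ n.+1]exprS.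
by field; rewrite ?expf_neq0 ?gt_eqF.
Qed.

Lemma perspective_tangent_le n a c r : 0 < a -> 0 < c -> 0 <= r ->
  n.+1%:R * r ^+ n * a - n%:R * r ^+ n.+1 * c <= perspective n a c.
Proof.
move=> a0 c0 r0; rewrite perspectiveE// -subr_ge0.
have := bernoulli_gap_ge0 n (ltW (divr_gt0 a0 c0)) r0.
move=> /(mulr_ge0 (ltW c0)); congr (0 <= _).
by move: (_ ^+ n.+1) (r ^+ n.+1) (r ^+ n) => x y z; field; rewrite gt_eqF.
Qed.

Lemma perspective_tangent_gap n a c r : 0 < a -> 0 < c -> 0 <= r ->
  n.+2%:R * r ^+ n.+1 * a - n.+1%:R * r ^+ n.+2 * c +
    n.+1%:R * r ^+ n * (c * (a / c - r) ^+ 2) <= perspective n.+1 a c.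
Proof.
move=> a0 c0 r0; rewrite perspectiveE// -subr_ge0.
have := bernoulli_gap_ge n (ltW (divr_gt0 a0 c0)) r0; rewrite -subr_ge0.
move=> /(mulr_ge0 (ltW c0)); congr (0 <= _).
move: (_ ^+ n.+2) (r ^+ n.+2) (r ^+ n.+1) (r ^+ n) => x y z w.
by field; rewrite gt_eqF.
Qed.

Lemma perspective_tangentE n a c (r := a / c) : 0 < c ->
  perspective n a c = n.+1%:R * r ^+ n * a - n%:R * r ^+ n.+1 * c.
Proof.
move=> c0; rewrite perspectiveE// -/r.
have -> : a = r * c by rewrite /r divfK// gt_eqF.
by rewrite -[n.+1%:R]natr1 exprS; ring.
Qed.

(** The tangent plane at the barycentre lies below [perspective], which is
    homogeneous of degree one, so it only depends on the slope
    [r = (u a + v b) / (u c + v e)]. *)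
Lemma perspective_convex n a b c e u v : 0 < a -> 0 < b -> 0 < c -> 0 < e ->
  0 <= u -> 0 <= v -> 0 < u + v ->
  perspective n (u * a + v * b) (u * c + v * e) <=
    u * perspective n a c + v * perspective n b e.
Proof.
move=> a0 b0 c0 e0 u0 v0 uv.
have mix_gt0 x y : 0 < x -> 0 < y -> 0 < u * x + v * y.
  move=> x0 y0; have [u_gt0|] := ltP 0 u.
    by rewrite ltr_pwDl ?mulr_gt0 ?mulr_ge0// ltW.
  move=> u_le0; have u00 : u = 0 by apply/le_anti; rewrite u0 u_le0.
  by rewrite u00 mul0r add0r mulr_gt0//; move: uv; rewrite u00 add0r.
rewrite perspective_tangentE ?mix_gt0//; set r := _ / _.
have r0 : 0 <= r by rewrite ltW// divr_gt0// mix_gt0.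
have := lerD (ler_wpM2l u0 (perspective_tangent_le n a0 c0 r0))
  (ler_wpM2l v0 (perspective_tangent_le n b0 e0 r0)).
by apply: le_trans; rewrite le_eqVlt; apply/orP; left; apply/eqP; ring.
Qed.

(** Only [a / c - b / e] is controlled: by homogeneity [perspective] is linear
    along rays through the origin. *)
Lemma perspective_midpoint n (delta M : R) : 0 < delta -> delta <= M ->
  exists2 k : R, 0 < k & forall a b c e,
    delta <= a <= M -> delta <= b <= M -> delta <= c <= M -> delta <= e <= M ->
    2 * perspective n.+1 ((a + b) / 2) ((c + e) / 2) +
      k * (a / c - b / e) ^+ 2 <= perspective n.+1 a c + perspective n.+1 b e.
Proof.
move=> d0 dM; have M0 : 0 < M by apply: lt_le_trans dM.
exists (n.+1%:R * (delta / M) ^+ n * (delta / 2)).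
  by rewrite !mulr_gt0 ?exprn_gt0 ?divr_gt0.
move=> a b c e /andP[da aM] /andP[db bM] /andP[dc cM] /andP[de eM].
have a0 := lt_le_trans d0 da; have b0 := lt_le_trans d0 db.
have c0 := lt_le_trans d0 dc; have e0 := lt_le_trans d0 de.
have m0 : 0 < (c + e) / 2 by rewrite divr_gt0// addr_gt0.
have r0 : 0 <= (a + b) / 2 / ((c + e) / 2).
  by rewrite !divr_ge0// addr_ge0// ltW.
have rd : delta / M <= (a + b) / 2 / ((c + e) / 2).
  rewrite ler_pdivlMr// mulrAC ler_pdivrMr//.
  by apply: ler_pM; rewrite ?divr_ge0 ?addr_ge0 ?(ltW c0) ?(ltW e0) ?(ltW d0)//; lra.
rewrite perspective_tangentE//; move: r0 rd; set r := _ / ((c + e) / 2) => r0 rd.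
have := lerD (perspective_tangent_gap n a0 c0 r0)
  (perspective_tangent_gap n b0 e0 r0).
apply: le_trans.
rewrite -subr_ge0.
rewrite [X in 0 <= X](_ : _ = n.+1%:R * (r ^+ n *
  (c * (a / c - r) ^+ 2 + e * (b / e - r) ^+ 2) -
   (delta / M) ^+ n * (delta / 2 * (a / c - b / e) ^+ 2))); last first.
  move: (a / c) (b / e) (delta / M) => x y z.
  move: (r ^+ n.+2) (r ^+ n.+1) (r ^+ n) (z ^+ n) => r2 r1 r3 z1.
  by field.
rewrite mulr_ge0// subr_ge0; apply: ler_pM.
- by rewrite exprn_ge0// divr_ge0// ltW.
- by rewrite mulr_ge0 ?sqr_ge0// divr_ge0// ltW.
- by rewrite lerXn2r ?nnegrE// divr_ge0// ltW.
apply: (@le_trans _ _ (delta * ((a / c - r) ^+ 2 + (b / e - r) ^+ 2))).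
  rewrite -mulrA ler_wpM2l ?(ltW d0)//.
  move: (a / c) (b / e) => x y; have := sqr_ge0 (x + y - 2 * r); nra.
by rewrite mulrDr lerD// ler_wpM2r ?sqr_ge0.
Qed.

(** The pointwise integrand of the dual function, for [nu = n + 1]. *)
Definition density n (lambda : R) a c : R :=
  n%:R^-1 * perspective n a c + lambda / n%:R * perspective n 1 a.

Lemma density_convex n lambda a b c e u v : 0 <= lambda ->
  0 < a -> 0 < b -> 0 < c -> 0 < e -> 0 <= u -> 0 <= v -> u + v = 1 ->
  density n lambda (u * a + v * b) (u * c + v * e) <=
    u * density n lambda a c + v * density n lambda b e.
Proof.
move=> l0 a0 b0 c0 e0 u0 v0 uv1.
have uv : 0 < u + v by rewrite uv1.
have := perspective_convex n a0 b0 c0 e0 u0 v0 uv.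
have := perspective_convex n ltr01 ltr01 a0 b0 u0 v0 uv.
rewrite !mulr1 uv1 /density => h1 h2.
have i0 : 0 <= n%:R^-1 :> R by rewrite invr_ge0.
have li0 : 0 <= lambda / n%:R by rewrite mulr_ge0.
have := lerD (ler_wpM2l i0 h2) (ler_wpM2l li0 h1).
by move/le_trans; apply; rewrite le_eqVlt; apply/orP; left; apply/eqP; ring.
Qed.

(** The gaps of the two perspective terms control [a/c - b/e] and
    [1/a - 1/b], which together control [a - b] and [c - e]. *)
Lemma density_midpoint n (lambda delta M : R) :
  0 < lambda -> 0 < delta -> delta <= M ->
  exists2 k : R, 0 < k & forall a b c e,
    delta <= a <= M -> delta <= b <= M -> delta <= c <= M -> delta <= e <= M ->
    2 * density n.+1 lambda ((a + b) / 2) ((c + e) / 2) +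
      k * ((a - b) ^+ 2 + (c - e) ^+ 2) <=
    density n.+1 lambda a c + density n.+1 lambda b e.
Proof.
move=> l0 d0 dM.
pose d' := Num.min delta 1; pose M' := Num.max M 1.
have d'0 : 0 < d' by rewrite lt_min d0 ltr01.
have d'1 : d' <= 1 by rewrite ge_min lexx orbT.
have M'1 : 1 <= M' by rewrite le_max lexx orbT.
have sub x : delta <= x <= M -> d' <= x <= M'.
  move=> /andP[dx xM]; rewrite ge_min dx/=.
  by rewrite (le_trans xM)// le_max lexx.
have [k k0 hk] := perspective_midpoint n d'0 (le_trans d'1 M'1).
pose h : R := n.+1%:R^-1 * Num.min 1 lambda * k.
have i0 : 0 < n.+1%:R^-1 :> R by rewrite invr_gt0.
have min0 : 0 < Num.min 1 lambda by rewrite lt_min ltr01.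
have h0 : 0 < h by rewrite !mulr_gt0.
have h1 : h <= n.+1%:R^-1 * k.
  by rewrite /h ler_wpM2r ?(ltW k0)// ler_piMr ?(ltW i0)// ge_min lexx.
have h2 : h <= lambda / n.+1%:R * k.
  rewrite /h ler_wpM2r ?(ltW k0)// mulrC ler_wpM2r ?(ltW i0)//.
  by rewrite ge_min lexx orbT.
pose K : R := M' ^+ 4 + 2 * (M' ^+ 4 + M' ^+ 6) / d' ^+ 2.
have M'0 : 0 < M' by rewrite (lt_le_trans ltr01).
have K0 : 0 < K.
  by rewrite addr_gt0 ?exprn_gt0// divr_gt0 ?exprn_gt0// mulr_gt0// addr_gt0 ?exprn_gt0.
exists (h / K); first by rewrite divr_gt0.
move=> a b c e /sub ha /sub hb /sub hc /sub he.
have a0 : 0 < a by case/andP: ha => /(lt_le_trans d'0).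
have b0 : 0 < b by case/andP: hb => /(lt_le_trans d'0).
have c0 : 0 < c by case/andP: hc => /(lt_le_trans d'0).
have e0 : 0 < e by case/andP: he => /(lt_le_trans d'0).
have H1 := hk _ _ _ _ ha hb hc he.
have h11 : d' <= 1 <= M' by rewrite d'1.
have H2 := hk _ _ _ _ h11 h11 ha hb.
set X := a / c - b / e in H1; set Y := 1 / a - 1 / b in H2.
(* [K] bounds the two squares by those of [X] and [Y] through these two
   identities. *)
have abE : a - b = - (a * b * Y) by rewrite /Y; field; rewrite !gt_eqF.
have ceE : a * (e - c) = c * e * X - c * (a - b).
  by rewrite /X; field; rewrite !gt_eqF.
have pow_le (x : R) m : 0 <= x -> x <= M' -> x ^+ m <= M' ^+ m.
  by move=> x0 xM; rewrite lerXn2r ?nnegrE// ltW.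
have aM : a <= M' by case/andP: ha.
have bM : b <= M' by case/andP: hb.
have cM : c <= M' by case/andP: hc.
have eM : e <= M' by case/andP: he.
have prod2 x y : 0 <= x -> x <= M' -> 0 <= y -> y <= M' ->
    (x * y) ^+ 2 <= M' ^+ 4.
  move=> x0 xM y0 yM; rewrite exprMn -[4%N]/(2 + 2)%N exprD.
  by apply: ler_pM; rewrite ?sqr_ge0 ?pow_le.
have Hab : (a - b) ^+ 2 <= M' ^+ 4 * Y ^+ 2.
  by rewrite abE sqrrN exprMn ler_wpM2r ?sqr_ge0// prod2// ltW.
have Hce : (c - e) ^+ 2 <=
    2 * (M' ^+ 4 + M' ^+ 6) / d' ^+ 2 * (X ^+ 2 + Y ^+ 2).
  rewrite mulrAC ler_pdivlMr ?exprn_gt0//.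
  apply: (@le_trans _ _ ((a * (e - c)) ^+ 2)).
    rewrite exprMn -[(c - e) ^+ 2]sqrrN opprB mulrC ler_wpM2r ?sqr_ge0//.
    by rewrite lerXn2r ?nnegrE ?(ltW d'0) ?(ltW a0)//; case/andP: ha.
  rewrite ceE.
  have B1 : (c * e * X) ^+ 2 <= M' ^+ 4 * X ^+ 2.
    by rewrite exprMn ler_wpM2r ?sqr_ge0// prod2// ltW.
  have B2 : (c * (a - b)) ^+ 2 <= M' ^+ 6 * Y ^+ 2.
    rewrite exprMn -[6%N]/(2 + 4)%N exprD -mulrA.
    by apply: ler_pM; rewrite ?sqr_ge0 ?pow_le// ltW.
  have P1 : 0 <= M' ^+ 4 * Y ^+ 2 by rewrite mulr_ge0 ?sqr_ge0 ?exprn_ge0// ltW.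
  have P2 : 0 <= M' ^+ 6 * X ^+ 2 by rewrite mulr_ge0 ?sqr_ge0 ?exprn_ge0// ltW.
  have := sqr_ge0 (c * e * X + c * (a - b)).
  nra.
have Hsum : h / K * ((a - b) ^+ 2 + (c - e) ^+ 2) <= h * (X ^+ 2 + Y ^+ 2).
  rewrite mulrAC ler_pdivrMr// -(mulrA h) ler_wpM2l ?(ltW h0)//.
  rewrite /K mulrDr [X in _ <= X + _]mulrC [X in _ <= _ + X]mulrC.
  apply: lerD => //; apply: (le_trans Hab).
  by rewrite ler_wpM2l ?exprn_ge0 ?(ltW M'0)// lerDr sqr_ge0.
rewrite -(lerD2l (2 * density n.+1 lambda ((a + b) / 2) ((c + e) / 2))) in Hsum.
apply: (le_trans Hsum).
have li0 : 0 <= lambda / n.+1%:R by rewrite mulr_ge0// ltW.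
have I1 := ler_wpM2l (ltW i0) H1; have I2 := ler_wpM2l li0 H2.
have II : (1 + 1) / 2 = 1 :> R by lra.
rewrite II in I2.
have J1 : h * X ^+ 2 <= n.+1%:R^-1 * k * X ^+ 2 by rewrite ler_wpM2r ?sqr_ge0.
have J2 : h * Y ^+ 2 <= lambda / n.+1%:R * k * Y ^+ 2 by rewrite ler_wpM2r ?sqr_ge0.
move: I1 I2 J1 J2; rewrite /density.
move: (perspective n.+1 _ _) (perspective n.+1 _ _) (perspective n.+1 _ _)
  (perspective n.+1 _ _) (perspective n.+1 _ _) (perspective n.+1 _ _)
  (n.+1%:R^-1) (lambda / _) (X ^+ 2) (Y ^+ 2)
  => f1 f2 f3 f4 f5 f6 i li x y I1 I2 J1 J2.
lra.
Qed.

End Density.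

(** * Means over a grid *)

Section GridMean.
Variables (R : realType) (d : nat) (N : 'I_d -> nat).
Hypothesis N_gt0 : forall j, (0 < N j)%N.
Implicit Types (f g : d.-tuple R -> R) (l : grid_index N).

Lemma card_grid_index : #|{: grid_index N}| = (\prod_(j < d) N j)%N.
Proof.
rewrite card_dep_ffun foldrE big_map big_enum/=.
by apply: eq_bigr => j _; rewrite card_ord.
Qed.

Lemma grid_size_gt0 : 0 < (\prod_(j < d) N j)%N%:R :> R.
Proof. by rewrite ltr0n prodn_gt0. Qed.

Lemma grid_mean_cst (a : R) : grid_mean N (fun=> a) = a.
Proof.
rewrite /grid_mean sumr_const card_grid_index -[a *+ _]mulr_natl mulrA.
by rewrite mulVf ?mul1r// gt_eqF// grid_size_gt0.
Qed.

Lemma grid_mean_le f g :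
  (forall l, f (grid_point R l) <= g (grid_point R l)) ->
  grid_mean N f <= grid_mean N g.
Proof.
by move=> fg; rewrite ler_wpM2l ?invr_ge0// ler_sum.
Qed.

Lemma grid_mean_lin f g (u v : R) :
  grid_mean N (fun t => u * f t + v * g t) =
  u * grid_mean N f + v * grid_mean N g.
Proof.
by rewrite /grid_mean big_split/= -!mulr_sumr mulrDr !(mulrCA _ u) !(mulrCA _ v).
Qed.

Lemma grid_mean_sum (I : finType) (F : I -> d.-tuple R -> R) :
  grid_mean N (fun t => \sum_i F i t) = \sum_i grid_mean N (F i).
Proof. by rewrite /grid_mean exchange_big mulr_sumr. Qed.

Lemma grid_meanZ f (u : R) :
  grid_mean N (fun t => u * f t) = u * grid_mean N f.
Proof. by rewrite /grid_mean -mulr_sumr mulrCA. Qed.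

Lemma eq_grid_mean f g :
  (forall l, f (grid_point R l) = g (grid_point R l)) ->
  grid_mean N f = grid_mean N g.
Proof. by move=> fg; congr (_ * _); apply: eq_bigr => l _. Qed.

Definition shift_index j l : grid_index N :=
  [ffun i => if i == j then ordS (l i) else l i].

Lemma shift_index_inj j : injective (shift_index j).
Proof.
move=> l l' /ffunP e; apply/ffunP => i; have := e i; rewrite !ffunE.
by case: ifP => // _ /ordS_inj.
Qed.

Lemma pairing_shift (k : 'rV[int]_d) j l : exists z : int,
  pairing k (grid_point R (shift_index j l)) = pairing k (grid_point R l) +
    2 * pi * (k ord0 j)%:~R / (N j)%:R + 2 * pi * z%:~R.
Proof.
have Nj : (N j)%:R != 0 :> R by rewrite pnatr_eq0 -lt0n.
have E z : (k ord0 j)%:~R * (2 * pi / (N j)%:R * (ordS (l j))%:R) =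
    (k ord0 j)%:~R * (2 * pi / (N j)%:R * (l j)%:R) +
    2 * pi * (k ord0 j)%:~R / (N j)%:R + 2 * pi * z%:~R :> R ->
  pairing k (grid_point R (shift_index j l)) = pairing k (grid_point R l) +
    2 * pi * (k ord0 j)%:~R / (N j)%:R + 2 * pi * z%:~R.
  move=> h; rewrite /pairing (bigD1 j)//= [in RHS](bigD1 j)//=.
  rewrite !tnth_mktuple ffunE eqxx h -!addrA; congr (_ + _).
  rewrite [RHS]addrC -addrA; congr (_ + (_ + _)).
  by apply: eq_bigr => i ij; rewrite !tnth_mktuple ffunE (negPf ij).
have := ltn_ord (l j); rewrite leq_eqVlt => /orP[/eqP lN|lN].
  have NE : (l j)%:R = (N j)%:R - 1 :> R by apply/esym/eqP; rewrite subr_eq natr1 lN.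
  exists (- k ord0 j); apply: E; rewrite /= lN modnn mulrNz NE.
  by move: Nj; move: (N j)%:R => x x0; field.
exists 0; apply: E; rewrite /= modn_small// -[(l j).+1%:R]natr1; ring.
Qed.

(** Shifting one coordinate of the grid cyclically multiplies the character
    sum by a root of unity, which is not [1] for a nonzero frequency below
    the grid size. *)
Lemma grid_mean_cos_eq0 (k : 'rV[int]_d) :
  (forall j, absz (k ord0 j) < N j)%N -> k != 0 ->
  grid_mean N (fun t : d.-tuple R => cos (pairing k t)) = 0.
Proof.
move=> kN k0.
have [j kj] : exists j, k ord0 j != 0.
  apply/existsP; apply: contra_neqT k0; rewrite negb_exists => /forallP h.
  by apply/rowP => j; rewrite mxE; apply/eqP; have := h j; rewrite negbK.
pose a : R := 2 * pi * (k ord0 j)%:~R / (N j)%:R.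
pose C : R := \sum_(l : grid_index N) cos (pairing k (grid_point R l)).
pose S : R := \sum_(l : grid_index N) sin (pairing k (grid_point R l)).
(* [(C, S)] is invariant under the rotation of angle [a]. *)
have EC : C = cos a * C - sin a * S.
  rewrite {1}/C (reindex_inj (shift_index_inj (j := j)))/=.
  rewrite !mulr_sumr -sumrB; apply: eq_bigr => l _.
  by have [z ->] := pairing_shift k j l; rewrite cosD2npi cosD -/a; ring.
have ES : S = sin a * C + cos a * S.
  rewrite {1}/S (reindex_inj (shift_index_inj (j := j)))/=.
  rewrite !mulr_sumr -big_split; apply: eq_bigr => l _ /=.
  by have [z ->] := pairing_shift k j l; rewrite sinD2npi sinD -/a; ring.
have ca : cos a < 1.
  have Nj : 0 < (N j)%:R :> R by rewrite ltr0n.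
  have -> : cos a = cos `|a|.
    by have [h|h] := leP 0 a; [rewrite ger0_norm|rewrite ltr0_norm// cosN].
  have aE : `|a| = 2 * pi * (absz (k ord0 j))%:R / (N j)%:R.
    by rewrite !normrM normfV normr_intr_absz !ger0_norm ?pi_ge0.
  apply: cos_lt1; rewrite aE divr_gt0 ?mulr_gt0 ?pi_gt0 ?ltr0n ?absz_gt0//=.
  by rewrite ltr_pdivrMr// ltr_pM2l ?pi2_gt0// ltr_nat.
have C0 : (1 - cos a) * C = 0.
  have := cos2Dsin2 a; move: EC ES ca; move: (cos a) (sin a) => x y.
  move=> EC ES x1 xy.
  have h1 : (1 - x) * C = - y * S by rewrite mulrBl mul1r {1}EC; ring.
  have h2 : (1 - x) * S = y * C by rewrite mulrBl mul1r {1}ES; ring.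
  have : (1 - x) * ((1 - x) * C) = - y * (y * C) by rewrite h1 -h2; ring.
  move=> h; have yE : y ^+ 2 = 1 - x ^+ 2 by rewrite -xy; ring.
  have : 2 * ((1 - x) * C) = 0.
    have -> : 2 * ((1 - x) * C) = (1 - x) * ((1 - x) * C) + y ^+ 2 * C.
      by rewrite yE; ring.
    by rewrite h; ring.
  by move/eqP; rewrite mulf_eq0 pnatr_eq0/= => /eqP.
have : C = 0.
  by move/eqP: C0; rewrite mulf_eq0 subr_eq0 eq_sym lt_eqF//= => /eqP.
by rewrite /grid_mean -/C => ->; rewrite mulr0.
Qed.

Lemma grid_mean_cos (k : 'rV[int]_d) :
  (forall j, absz (k ord0 j) < N j)%N ->
  grid_mean N (fun t : d.-tuple R => cos (pairing k t)) = (k == 0)%:R.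
Proof.
move=> kN; have [->|] := eqVneq k 0; last exact: grid_mean_cos_eq0.
rewrite -[RHS](grid_mean_cst 1%:R); apply: eq_grid_mean => l.
by rewrite /pairing big1 ?cos0// => j _; rewrite mxE mul0r.
Qed.

(** [f] may be negative or infinite off the grid, which has full measure. *)
Lemma grid_integral (f : d.-tuple R -> \bar R) (g : d.-tuple R -> R) :
  measurable_fun setT f ->
  (forall l, f (grid_point R l) = (g (grid_point R l))%:E) ->
  (forall l, 0 <= g (grid_point R l)) ->
  (\int[grid_measure N]_(t in torus) f t)%E = (grid_mean N g)%:E.
Proof.
move=> mf fg g0.
have c0 : 0 <= ((\prod_(j < d) N j)%N%:R^-1 : R) by rewrite invr_ge0.
pose n := #|{: grid_index N}|.
(* Enumerating the grid writes its measure as a sum of scaled Dirac masses;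
   indices beyond its size get the null measure. *)
pose m (i : nat) : {measure set (d.-tuple R) -> \bar R} :=
  if insub i is Some i' then
    mscale (NngNum c0) (\d_(grid_point R (enum_val (i' : 'I_n))))
  else mzero.
have mE (h : d.-tuple R -> \bar R) : (forall t, 0 <= h t)%E ->
    measurable_fun setT h ->
    (\int[grid_measure N]_(t in torus) h t)%E =
    (\sum_(l : grid_index N) ((\prod_(j < d) N j)%N%:R^-1)%:E *
       h (grid_point R l))%E.
  move=> h0 mh; rewrite (eq_measure_integral (msum m n)); last first.
    move=> A mA _; rewrite /= /grid_measure /msum big_enum_val/=.
    by apply: eq_bigr => i _; rewrite /m valK.
  rewrite ge0_integral_measure_sum//; last exact: measurable_funTS.
  rewrite [RHS]big_enum_val/=; apply: eq_bigr => i _; rewrite /m valK.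
  rewrite ge0_integral_mscale//; last exact: measurable_funTS.
  rewrite integral_dirac//; last exact: measurable_funTS.
  by rewrite diracE mem_set ?mul1e//; exact: grid_point_torus.
rewrite integralE mE//; last exact: measurable_funepos.
rewrite mE//; last exact: measurable_funeneg.
rewrite [X in (_ - X)%E]big1 ?sube0; last first.
  by move=> l _; rewrite funenegE fg -EFinN max_r ?mule0// lee_fin oppr_le0.
rewrite /grid_mean mulr_sumr -sumEFin; apply: eq_bigr => l _.
by rewrite funeposE fg max_l ?lee_fin.
Qed.

Variable L : {fset 'rV[int]_d}.
Hypothesis L_opp : forall k : 'rV[int]_d, k \in L -> - k \in L.

(** Products of cosines have frequencies [k + l] and [k - l], bounded by twice
    the largest one in [L]; below the grid size only the pairs [l = k] and
    [l = - k] contribute. *)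
Lemma parseval (p : coefs R L) : even_coefs p ->
  (forall j, (freq_bound L).*2 < N j)%N ->
  grid_mean N (fun t => poly_val p t ^+ 2) = \sum_(k : L) p k ^+ 2.
Proof.
move=> pe LN.
have pairD (k l : 'rV[int]_d) t :
    pairing (k + l) t = pairing k t + pairing l t :> R.
  by rewrite /pairing -big_split; apply: eq_bigr => j _; rewrite mxE rmorphD mulrDl.
have pairN (l : 'rV[int]_d) t : pairing (- l) t = - pairing l t :> R.
  by rewrite /pairing -sumrN; apply: eq_bigr => j _; rewrite mxE mulrNz mulNr.
have E : (fun t => poly_val p t ^+ 2) = (fun t => \sum_(k : L) \sum_(l : L)
    (p k * p l / 2) * (cos (pairing (val k + val l) t) +
      cos (pairing (val k - val l) t))).
  apply/funext => t; rewrite expr2 poly_valE mulr_suml; apply: eq_bigr => k _.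
  rewrite mulr_sumr; apply: eq_bigr => l _.
  by rewrite !pairD pairN cosD cosB; field.
have bnd (k l : L) j : (absz ((val k + val l)%R ord0 j) < N j)%N /\
    (absz ((val k - val l)%R ord0 j) < N j)%N.
  rewrite !mxE; have lt (a b : int) : (absz a <= freq_bound L)%N ->
      (absz b <= freq_bound L)%N -> (absz (a + b)%R < N j)%N.
    move=> aL bL; apply: leq_ltn_trans (LN j); rewrite -addnn.
    apply: leq_trans (leq_add aL bL).
    by rewrite -lez_nat PoszD !abszE ler_normD.
  by split; apply: lt; rewrite ?abszN; exact: freq_boundP.
have oppP (k : L) : exists k' : L, val k' = - val k.
  by exists [` L_opp (valP k)]%fset.
rewrite E grid_mean_sum; apply: eq_bigr => k _; rewrite grid_mean_sum.
have [k' k'E] := oppP k.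
rewrite (eq_bigr (fun l : L => p k * p l / 2 * ((l == k')%:R + (l == k)%:R)));
  last first.
  move=> l _; rewrite grid_meanZ; congr (_ * _).
  rewrite (_ : (fun t => _) = fun t => 1 * cos (pairing (val k + val l) t) +
     1 * cos (pairing (val k - val l) t)); last first.
    by apply/funext => t; rewrite !mul1r.
  rewrite grid_mean_lin !mul1r !grid_mean_cos; last 2 first.
  - by move=> j; have [] := bnd k l j.
  - by move=> j; have [] := bnd k l j.
  congr (_%:R + _%:R).
    by rewrite addrC addr_eq0 -k'E (inj_eq val_inj).
  by rewrite subr_eq0 (inj_eq val_inj) eq_sym.
rewrite (eq_bigr (fun l : L => (if l == k' then p k * p l / 2 else 0) +
    (if l == k then p k * p l / 2 else 0))); last first.
  by move=> l _; rewrite mulrDr; congr (_ + _); case: eqP; rewrite ?mulr1 ?mulr0.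
by rewrite big_split/= -!big_mkcond !big_pred1_eq (pe k k' k'E); field.
Qed.

End GridMean.

(** * The objective as a function of the mean *)

Section Lipschitz.
Variables (R : realType) (d : nat).
Implicit Types (f g : d.-tuple R -> R) (C D : R) (t s : d.-tuple R).

(** The Lipschitz constant of a product involves bounds on its factors, so the
    two are carried together, by a common number for simplicity. *)
Definition lip_by C f := forall t s, torus t -> torus s ->
  `|f t| <= C /\ `|f t - f s| <= C * \sum_(j < d) `|tnth t j - tnth s j|.

Let dist_ge0 t s : 0 <= \sum_(j < d) `|tnth t j - tnth s j|.
Proof. exact: sumr_ge0. Qed.

Lemma lip_byM C D f g : lip_by C f -> lip_by D g ->
  lip_by (2 * C * D) (fun t => f t * g t).
Proof.
move=> lf lg t s tt ss; have [f1 f2] := lf t s tt ss.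
have [g1 g2] := lg t s tt ss; have [g3 _] := lg s t ss tt.
have C0 : 0 <= C := le_trans (normr_ge0 _) f1.
have D0 : 0 <= D := le_trans (normr_ge0 _) g1.
have CD0 : 0 <= C * D by rewrite mulr_ge0.
split; first by rewrite normrM (le_trans (ler_pM _ _ f1 g1))//; lra.
have -> : f t * g t - f s * g s = f t * (g t - g s) + (f t - f s) * g s by ring.
rewrite (le_trans (ler_normD _ _))// !normrM.
move: (dist_ge0 t s) f2 g2; move: (\sum_j _) => X X0 f2 g2.
rewrite (_ : 2 * C * D * X = C * (D * X) + (C * X) * D); last by ring.
by rewrite lerD// ler_pM.
Qed.

Lemma lip_byX C m : 0 <= C -> exists2 D, 0 <= D &
  forall f, lip_by C f -> lip_by D (fun t => f t ^+ m).
Proof.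
move=> C0; elim: m => [|m [D D0 IH]].
  exists 1 => // f _ t s _ _; rewrite !expr0 subrr normr1 normr0 mul1r.
  by split.
exists (2 * C * D); first by rewrite !mulr_ge0.
move=> f lf; have -> : (fun t => f t ^+ m.+1) = fun t => f t * f t ^+ m.
  by apply/funext => t; rewrite exprS.
by apply: lip_byM => //; exact: IH.
Qed.

Lemma lip_byV C delta f : 0 < delta -> (forall t, torus t -> delta <= f t) ->
  lip_by C f -> lip_by (delta^-1 + C / delta ^+ 2) (fun t => (f t)^-1).
Proof.
move=> d0 fd lf t s tt ss; have [f1 f2] := lf t s tt ss.
have C0 : 0 <= C := le_trans (normr_ge0 _) f1.
have ft := lt_le_trans d0 (fd t tt); have fs := lt_le_trans d0 (fd s ss).
have e0 : 0 <= C / delta ^+ 2 by rewrite divr_ge0// sqr_ge0.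
have i0 : 0 <= delta^-1 by rewrite invr_ge0 ltW.
split.
  rewrite ger0_norm ?invr_ge0 ?(ltW ft)//.
  have : (f t)^-1 <= delta^-1 by rewrite lef_pV2 ?posrE ?fd.
  lra.
have -> : (f t)^-1 - (f s)^-1 = - (f t - f s) / (f t * f s).
  by field; rewrite !gt_eqF.
rewrite normrM normrN normfV [X in _ / X]ger0_norm ?mulr_ge0 ?(ltW ft) ?(ltW fs)//.
apply: (@le_trans _ _ (C / delta ^+ 2 * \sum_(j < d) `|tnth t j - tnth s j|)).
  rewrite mulrAC ler_pM ?invr_ge0 ?mulr_ge0 ?(ltW ft) ?(ltW fs)//.
  by rewrite lef_pV2 ?posrE ?mulr_gt0 ?exprn_gt0// expr2 ler_pM ?(ltW d0) ?fd.
by rewrite ler_wpM2r// lerDr.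
Qed.

Lemma lip_by_lin C D u v f g : lip_by C f -> lip_by D g ->
  lip_by (`|u| * C + `|v| * D) (fun t => u * f t + v * g t).
Proof.
move=> lf lg t s tt ss; have [f1 f2] := lf t s tt ss.
have [g1 g2] := lg t s tt ss; split.
  by rewrite (le_trans (ler_normD _ _))// !normrM lerD// ler_wpM2l.
have -> : u * f t + v * g t - (u * f s + v * g s) =
  u * (f t - f s) + v * (g t - g s) by ring.
by rewrite (le_trans (ler_normD _ _))// !normrM mulrDl -!mulrA lerD// ler_wpM2l.
Qed.

Lemma lip_by_integrable C f : lip_by C f -> measurable_fun setT f ->
  (torus_measure R d).-integrable torus (EFin \o f).
Proof.
move=> lf mf; apply: measurable_bounded_integrable => //.
- by rewrite [X in (X < _)%E]torus_measureT ltry.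
- exact: measurable_funTS.
- exists C; split; first exact: num_real.
  move=> M CM t tt /=; have [h _] := lf t t tt tt.
  exact: le_trans h (ltW CM).
Qed.

End Lipschitz.

Section Objective.
Variables (R : realType) (d : nat) (L : {fset 'rV[int]_d}).
Variables (n : nat) (lambda : R) (c m : L -> R).
Implicit Types (p q : coefs R L) (x y : coefs R L * coefs R L).
Implicit Types (t s : d.-tuple R) (N : 'I_d -> nat).

Definition dual_density x t : R :=
  density n.+1 lambda (poly_val x.1 t) (poly_val x.2 t).

(** The finite values of the dual function, as a function of the mean [A] used
    for integration: the torus mean or a grid mean. *)
Definition objective (A : (d.-tuple R -> R) -> R) x : R :=
  A (dual_density x) + \sum_(k : L) x.2 k * c k - \sum_(k : L) x.1 k * m k.

Definition above (delta : R) x := forall t,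
  delta <= poly_val x.1 t /\ delta <= poly_val x.2 t.

Definition coefs_le (C : R) x := coef_sum x.1 <= C /\ coef_sum x.2 <= C.

Lemma poly_val_lip_by p (C : R) : coef_sum p <= C ->
  lip_by (C * (1 + (freq_bound L)%:R)) (poly_val p).
Proof.
move=> pC t s tt ss; have C0 := le_trans (coef_sum_ge0 p) pC.
split.
  rewrite (le_trans (poly_val_norm_le p t))// (le_trans pC)//.
  by rewrite ler_peMr// lerDl.
rewrite (le_trans (poly_val_lip p t s))// -mulrA ler_pM ?coef_sum_ge0//.
  by rewrite mulr_ge0// sumr_ge0.
by rewrite ler_wpM2r ?sumr_ge0// lerDr.
Qed.

Lemma measurable_perspective k x : measurable_fun setT
  (fun t => perspective k (poly_val x.1 t) (poly_val x.2 t)).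
Proof.
apply: measurable_funM; first by apply: measurable_funX; exact: measurable_poly_val.
exact: measurable_inv_poly_val.
Qed.

Lemma perspective1E k (a : R) : perspective k 1 a = (a ^+ k)^-1.
Proof. by rewrite /perspective expr1n mul1r. Qed.

Lemma perspective_lip_by (C delta : R) : 0 <= C -> 0 < delta ->
  exists2 D, 0 <= D & forall x, coefs_le C x -> above delta x ->
    lip_by D (fun t => perspective n.+1 (poly_val x.1 t) (poly_val x.2 t)) /\
    lip_by D (fun t => perspective n.+1 1 (poly_val x.1 t)).
Proof.
move=> C0 d0; pose C1 := C * (1 + (freq_bound L)%:R).
have C10 : 0 <= C1 by rewrite mulr_ge0// addr_ge0.
have [D1 D10 h1] := @lip_byX R d C1 n.+2 C10.
have [D2 D20 h2] := @lip_byX R d C1 n.+1 C10.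
pose D3 := (delta ^+ n.+1)^-1 + D2 / (delta ^+ n.+1) ^+ 2.
have D30 : 0 <= D3 by rewrite addr_ge0 ?divr_ge0 ?invr_ge0 ?exprn_ge0// ltW.
have hV p : coef_sum p <= C -> (forall t, delta <= poly_val p t) ->
    lip_by D3 (fun t => (poly_val p t ^+ n.+1)^-1).
  move=> pC pd; apply: lip_byV; first exact: exprn_gt0.
    by move=> t _; rewrite lerXn2r ?nnegrE ?(ltW d0) ?(le_trans (ltW d0)).
  exact/h2/poly_val_lip_by.
have wk D D' f : lip_by D f -> D <= D' -> lip_by D' (f : d.-tuple R -> R).
  move=> lf DD t s tt ss; have [f1 f2] := lf t s tt ss.
  by split; [exact: le_trans DD|rewrite (le_trans f2)// ler_wpM2r// sumr_ge0].
have D130 : 0 <= 2 * D1 * D3 by rewrite !mulr_ge0.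
exists (2 * D1 * D3 + D3); first by rewrite addr_ge0.
move=> x [xC yC] ab; split.
  apply: (@wk (2 * D1 * D3)); last by rewrite lerDl.
  apply: lip_byM; first exact/h1/poly_val_lip_by.
  by apply: hV => // t; case: (ab t).
apply: (@wk D3); last by rewrite lerDr.
under eq_fun do rewrite perspective1E.
by apply: hV => // t; case: (ab t).
Qed.

Lemma perspective_integrable (delta : R) x : 0 < delta -> above delta x ->
  (torus_measure R d).-integrable torus
     (EFin \o (fun t => perspective n.+1 (poly_val x.1 t) (poly_val x.2 t))) /\
  (torus_measure R d).-integrable torus
     (EFin \o (fun t => perspective n.+1 1 (poly_val x.1 t))).
Proof.
move=> d0 ab; pose C := coef_sum x.1 + coef_sum x.2.
have C0 : 0 <= C by rewrite addr_ge0 ?coef_sum_ge0.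
have [D _ /(_ x)[]//] := perspective_lip_by C0 d0.
  by split; rewrite ?lerDl ?lerDr ?coef_sum_ge0.
move=> l1 l2; split; first exact: (lip_by_integrable l1 (measurable_perspective _ _)).
apply: (lip_by_integrable l2).
under eq_fun do rewrite perspective1E.
exact: measurable_inv_poly_val.
Qed.

Let nuE : (n.+2%:R - 1 : R) = n.+1%:R.
Proof. by rewrite -[n.+2%:R]natr1 addrK. Qed.

Let integrandE1 (a b : R) : 0 < b ->
  ((a ^+ n.+2)%:E / (b ^+ n.+1)%:E)%E = (perspective n.+1 a b)%:E.
Proof. by move=> b0; rewrite inver gt_eqF ?exprn_gt0. Qed.

Let integrandE2 (b : R) : 0 < b ->
  (1 / (b ^+ n.+1)%:E)%E = (perspective n.+1 1 b)%:E.
Proof. by move=> b0; rewrite inver gt_eqF ?exprn_gt0// perspective1E mul1e. Qed.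

Lemma dual_fun_grid N x :
  (forall t, grid N t -> 0 < poly_val x.1 t /\ 0 < poly_val x.2 t) ->
  dual_fun (grid_measure N) n.+2 lambda c m x =
    (objective (grid_mean N) x)%:E.
Proof.
move=> xN; rewrite /dual_fun nuE /= /objective.
have gN (l : grid_index N) : grid N (grid_point R l) by exists l.
rewrite (grid_integral (g := fun t =>
    perspective n.+1 (poly_val x.1 t) (poly_val x.2 t))); last 3 first.
- apply: emeasurable_funM; last exact: measurable_inve_poly_val.
  by apply/measurable_EFinP/measurable_funX; exact: measurable_poly_val.
- by move=> l; have [_ h] := xN _ (gN l); rewrite integrandE1.
- move=> l; have [h1 h2] := xN _ (gN l).
  by rewrite divr_ge0// exprn_ge0// ltW.
rewrite (grid_integral (g := fun t =>
    perspective n.+1 1 (poly_val x.1 t))); last 3 first.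
- by under eq_fun do rewrite mul1e; exact: measurable_inve_poly_val.
- by move=> l; have [h _] := xN _ (gN l); rewrite integrandE2.
- move=> l; have [h1 h2] := xN _ (gN l).
  by rewrite divr_ge0// exprn_ge0// ltW.
rewrite -!EFinM -?EFinN -!EFinD; congr _%:E.
by rewrite grid_mean_lin mul1r; ring.
Qed.

Lemma dual_fun_torus (delta : R) x : 0 < delta -> above delta x ->
  dual_fun (torus_measure R d) n.+2 lambda c m x =
    (objective (@torus_mean R d) x)%:E.
Proof.
move=> d0 ab; rewrite /dual_fun nuE /= /objective.
have [i1 i2] := perspective_integrable d0 ab.
rewrite (eq_integral (fun t =>
    (perspective n.+1 (poly_val x.1 t) (poly_val x.2 t))%:E)); last first.
  by move=> t _; rewrite integrandE1//; case: (ab t) => _; exact: lt_le_trans.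
rewrite [X in (_ + _ * X)%E](eq_integral (fun t =>
    (perspective n.+1 1 (poly_val x.1 t))%:E)); last first.
  by move=> t _; rewrite integrandE2//; case: (ab t) => + _; exact: lt_le_trans.
rewrite -(fineK (integrable_fin_num _ i1))// -(fineK (integrable_fin_num _ i2))//.
rewrite -!EFinM -?EFinN -!EFinD; congr _%:E.
rewrite /torus_mean /dual_density /density RintegralD//; last 2 first.
- exact: (integrableZl _ _ i1).
- exact: (integrableZl _ _ i2).
rewrite (RintegralZl _ _ i1)// (RintegralZl _ _ i2)// /Rintegral.
by rewrite div1r; ring.
Qed.

(** On any set of coefficients bounded above and with values bounded below,
    the integrands are equi-Lipschitz, so the grid objectives converge
    uniformly. *)
Lemma objective_dist (C delta : R) : 0 <= C -> 0 < delta ->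
  exists2 D, 0 <= D & forall x N, coefs_le C x -> above delta x ->
    (forall j, 0 < N j)%N ->
    `|objective (@torus_mean R d) x - objective (grid_mean N) x| <=
      D * \sum_(j < d) (2 * pi / (N j)%:R).
Proof.
move=> C0 d0; have [D D0 hD] := perspective_lip_by C0 d0.
have i0 : 0 <= `|n.+1%:R^-1| * D + `|lambda / n.+1%:R| * D.
  by rewrite addr_ge0// mulr_ge0.
exists (`|n.+1%:R^-1| * D + `|lambda / n.+1%:R| * D) => // x N xC ab N0.
have [l1 l2] := hD x xC ab; have [i1 i2] := perspective_integrable d0 ab.
have ld := lip_by_lin n.+1%:R^-1 (lambda / n.+1%:R) l1 l2.
rewrite /objective [X in `|X|](_ : _ = torus_mean (dual_density x) -
  grid_mean N (dual_density x)); last by ring.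
apply: riemann_sum_dist => //.
- apply: (lip_by_integrable ld); apply: measurable_funD.
    by apply: measurable_funM => //; exact: measurable_perspective.
  apply: measurable_funM => //.
  under eq_fun do rewrite perspective1E.
  exact: measurable_inv_poly_val.
- by move=> t s tt ss; case: (ld t s tt ss).
Qed.

End Objective.

(** * Continuity and compactness in the coefficient space *)

Section Continuity.
Variables (R : realType) (T : topologicalType).
Implicit Types (x : T).

Lemma continuous_at_sum (I : finType) (F : I -> T -> R) x :
  (forall i, {for x, continuous (F i)}) ->
  {for x, continuous (fun z => \sum_i F i z)}.
Proof.
move=> cF; apply: cvg_big; [exact: add_continuous|].
by move=> i _; exact: cF.
Qed.

Lemma continuous_at_X (f : T -> R) n x : {for x, continuous f} ->
  {for x, continuous (fun z => f z ^+ n)}.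
Proof.
move=> cf; elim: n => [|n IH].
  rewrite (_ : (fun z => _) = fun=> 1); first exact: cst_continuous.
  by apply/funext => z; rewrite expr0.
rewrite (_ : (fun z => _) = (fun z => f z * f z ^+ n)).
  exact: continuousM.
by apply/funext => z; rewrite exprS.
Qed.

Lemma continuous_at_density n (lambda : R) (f g : T -> R) x :
  0 < f x -> 0 < g x -> {for x, continuous f} -> {for x, continuous g} ->
  {for x, continuous (fun z => density n lambda (f z) (g z))}.
Proof.
move=> f0 g0 cf cg; rewrite /density /perspective.
have cV (h : T -> R) m : 0 < h x -> {for x, continuous h} ->
    {for x, continuous (fun z => (h z ^+ m)^-1 : R)}.
  move=> h0 ch; apply: continuousV; first by rewrite expf_neq0// gt_eqF.
  exact: continuous_at_X.
apply: continuousD; apply: continuousM; try exact: cst_continuous.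
- by apply: continuousM; [exact: continuous_at_X|exact: cV].
- by apply: continuousM; [exact: cst_continuous|exact: cV].
Qed.

End Continuity.

Section CoefSpace.
Variables (R : realType) (d : nat) (L : {fset 'rV[int]_d}).
Implicit Types (p : coefs R L) (x y : coefs R L * coefs R L).
Implicit Types (t : d.-tuple R) (N : 'I_d -> nat).

Lemma continuous_coef (k : L) : continuous (fun p => p k).
Proof. exact: (@proj_continuous L (fun=> R) k). Qed.

Lemma continuous_coef1 (k : L) : continuous (fun x => x.1 k).
Proof.
move=> x; apply: (@continuous_comp _ _ _ fst (fun p => p k)).
  exact: cvg_fst.
exact: continuous_coef.
Qed.

Lemma continuous_coef2 (k : L) : continuous (fun x => x.2 k).
Proof.
move=> x; apply: (@continuous_comp _ _ _ snd (fun p => p k)).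
  exact: cvg_snd.
exact: continuous_coef.
Qed.

Lemma continuous_poly_val t : continuous (fun p => poly_val p t).
Proof.
move=> p; rewrite (_ : (fun p => _) = fun p => \sum_(k : L)
    p k * cos (pairing (val k) t)); last by apply/funext => q; exact: poly_valE.
apply: continuous_at_sum => k; apply: continuousM; last exact: cst_continuous.
exact: continuous_coef.
Qed.

Lemma continuous_poly_val1 t : continuous (fun x => poly_val x.1 t).
Proof.
move=> x; apply: (@continuous_comp _ _ _ fst (fun p => poly_val p t)).
  exact: cvg_fst.
exact: continuous_poly_val.
Qed.

Lemma continuous_poly_val2 t : continuous (fun x => poly_val x.2 t).
Proof.
move=> x; apply: (@continuous_comp _ _ _ snd (fun p => poly_val p t)).
  exact: cvg_snd.
exact: continuous_poly_val.
Qed.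

Lemma closed_coefs_eq (T : topologicalType) (f g : T -> R) :
  continuous f -> continuous g -> closed [set z | f z = g z].
Proof.
move=> cf cg; have -> : [set z | f z = g z] = (fun z => f z - g z) @^-1` [set 0].
  by apply/seteqP; split => z /=; [move=> ->; rewrite subrr|move/subr0_eq].
apply: preimage_closed; last exact: closed_eq.
by move=> z _; apply: continuousB; [exact: cf|exact: cg].
Qed.

Definition admissible : set (coefs R L * coefs R L) :=
  [set x | [/\ even_coefs x.1, even_coefs x.2 & unit_const x.1]].

Lemma closed_even_coefs : closed [set p : coefs R L | even_coefs p].
Proof.
rewrite (_ : [set p | _] = \bigcap_(kl in [set kl : L * L |
    val kl.2 = - val kl.1]) [set p : coefs R L | p kl.2 = p kl.1]).
  apply: closed_bigI => kl _; apply: closed_coefs_eq; exact: continuous_coef.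
apply/seteqP; split => [p pe [k l] /= kl|p h k l kl]; first exact: pe.
exact: (h (k, l) kl).
Qed.

Lemma closed_unit_const : closed [set p : coefs R L | unit_const p].
Proof.
rewrite (_ : [set p | _] =
    \bigcap_(k in [set k : L | val k = 0]) [set p : coefs R L | p k = 1]).
  apply: closed_bigI => k _; apply: closed_coefs_eq; first exact: continuous_coef.
  exact: cst_continuous.
by apply/seteqP; split => [p pe k /= kl|p h k kl]; [exact: pe|exact: (h k kl)].
Qed.

Lemma closed_admissible : closed admissible.
Proof.
rewrite (_ : admissible = fst @^-1` [set p : coefs R L | even_coefs p] `&`
    snd @^-1` [set p : coefs R L | even_coefs p] `&`
    fst @^-1` [set p : coefs R L | unit_const p]).
  apply: closedI; first apply: closedI; apply: preimage_closed.
  - by move=> x _; exact: cvg_fst.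
  - exact: closed_even_coefs.
  - by move=> x _; exact: cvg_snd.
  - exact: closed_even_coefs.
  - by move=> x _; exact: cvg_fst.
  - exact: closed_unit_const.
by apply/seteqP; split => [x [] //|x [[]]].
Qed.

(** Cubes rather than Euclidean balls: in the product topology their
    compactness is Tychonoff's theorem. *)
Definition cube (x0 : coefs R L * coefs R L) (rho : R) :
    set (coefs R L * coefs R L) :=
  [set x | (forall k, `|x.1 k - x0.1 k| <= rho) /\
           (forall k, `|x.2 k - x0.2 k| <= rho)].

Lemma compact_cube x0 rho : compact (cube x0 rho).
Proof.
have cpt p0 : compact [set p : coefs R L | forall k, `|p k - p0 k| <= rho].
  have -> : [set p : coefs R L | forall k, `|p k - p0 k| <= rho] =
      [set p | forall k, `[p0 k - rho, p0 k + rho]%classic (p k)].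
    by apply/seteqP; split => p h k; have := h k; rewrite /= in_itv/= ler_distl.
  apply: (@tychonoff L (fun=> R) (fun k => `[p0 k - rho, p0 k + rho]%classic)).
  by move=> k; exact: segment_compact.
rewrite (_ : cube x0 rho =
  [set p : coefs R L | forall k, `|p k - x0.1 k| <= rho] `*`
  [set p : coefs R L | forall k, `|p k - x0.2 k| <= rho]); last by [].
exact: compact_setX.
Qed.

(** In a compact cube a sequence converges as soon as all its coordinates
    do. *)
Lemma cluster_coordwise (x : nat -> coefs R L * coefs R L) x0 rho :
  (forall n, cube x0 rho (x n)) ->
  (forall e, 0 < e -> \forall n \near \oo, cube x0 e (x n)) ->
  cluster (x @ \oo) = [set x0].
Proof.
move=> xK xc.
have sub : cluster (x @ \oo) `<=` [set x0].
  move=> y cy.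
  suff E e : 0 < e -> cube x0 (e + e) y.
    have eq0 (a b : R) : (forall e : R, 0 < e -> `|a - b| <= e + e) -> a = b.
      move=> h; apply/eqP; rewrite -subr_eq0 -normr_le0 leNgt; apply/negP => ab.
      have := h _ (divr_gt0 ab (ltr0n R 3)); lra.
    rewrite /= (surjective_pairing y) (surjective_pairing x0).
    congr (_, _); apply: functional_extensionality_dep => k; apply: eq0 => e e0.
      by have [+ _] := E e e0; apply.
    by have [_ +] := E e e0; apply.
  move=> e0.
  have B1 k : nbhs y [set z : coefs R L * coefs R L | `|y.1 k - z.1 k| < e].
    have := @continuous_coef1 k y; move/cvgr_dist_lt => /(_ _ e0).
    exact.
  have B2 k : nbhs y [set z : coefs R L * coefs R L | `|y.2 k - z.2 k| < e].
    have := @continuous_coef2 k y; move/cvgr_dist_lt => /(_ _ e0).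
    exact.
  split=> k.
    have [z [zc zy]] := cy _ _ (xc e e0) (B1 k).
    have [/(_ k) z1 _] := zc; rewrite -(subrKA (z.1 k)).
    by rewrite (le_trans (ler_normD _ _))// lerD// ltW.
  have [z [zc zy]] := cy _ _ (xc e e0) (B2 k).
  have [_ /(_ k) z1] := zc; rewrite -(subrKA (z.2 k)).
  by rewrite (le_trans (ler_normD _ _))// lerD// ltW.
apply/seteqP; split => // y ->.
have [z [_ cz]] : cube x0 rho `&` cluster (x @ \oo) !=set0.
  by apply: compact_cube; exists 0%N => // n _; exact: xK.
by rewrite -(sub _ cz).
Qed.

Lemma continuous_at_objective n lambda c m N x :
  (forall t, grid N t -> 0 < poly_val x.1 t /\ 0 < poly_val x.2 t) ->
  {for x, continuous (@objective R d L n lambda c m (grid_mean N))}.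
Proof.
move=> xN; rewrite /objective /grid_mean; apply: continuousB.
  apply: continuousD.
    apply: continuousM; first exact: cst_continuous.
    apply: continuous_at_sum => l.
    have [h1 h2] := xN _ (imageT (@grid_point R d N) l).
    apply: continuous_at_density => //.
      exact: continuous_poly_val1.
    exact: continuous_poly_val2.
  apply: continuous_at_sum => k; apply: continuousM; last exact: cst_continuous.
  exact: continuous_coef2.
apply: continuous_at_sum => k; apply: continuousM; last exact: cst_continuous.
exact: continuous_coef1.
Qed.

End CoefSpace.

(** * The continuous minimizer is interior *)

Section Positivity.
Variables (R : realType) (d : nat) (L : {fset 'rV[int]_d}).
Hypothesis L_opp : forall k : 'rV[int]_d, k \in L -> - k \in L.
Implicit Types (p q : coefs R L) (t : d.-tuple R).

Lemma trig_poly_gt0_val p t : 0 < trig_poly p t -> 0 < poly_val p t.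
Proof. by rewrite ltcE => /andP[]. Qed.

(** The sines of [k] and [- k] cancel, so the value is real. *)
Lemma trig_poly_gt0 p t : even_coefs p ->
  0 < poly_val p t -> 0 < trig_poly p t.
Proof.
move=> pe pt; rewrite ltcE [X in _ && X]pt andbT.
pose opp_idx (k : L) : L := [` L_opp (valP k)]%fset.
have opp_inj : injective opp_idx.
  by move=> k l /(congr1 val)/= /oppr_inj/val_inj.
have E : complex.Im (trig_poly p t) =
    - \sum_(k : L) p k * sin (pairing (val k) t).
  rewrite /trig_poly raddf_sum -sumrN; apply: eq_bigr => k _ /=.
  by rewrite sinN mulrN mul0r addr0.
set S := \sum_k _ in E.
have : S = - S.
  rewrite {1}/S (reindex_inj opp_inj)/= -sumrN; apply: eq_bigr => k _ /=.
  rewrite (pe k (opp_idx k))// -mulrN -sinN; congr (_ * sin _).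
  by rewrite /pairing -sumrN; apply: eq_bigr => j _; rewrite mxE mulrNz mulNr.
move=> SN; rewrite E /= oppr_eq0.
by have : S = 0; [lra|move=> ->].
Qed.

Lemma poly_val_lin p q (u v : R) t :
  poly_val (fun k => u * p k + v * q k) t = u * poly_val p t + v * poly_val q t.
Proof.
rewrite !poly_valE !mulr_sumr -big_split/=; apply: eq_bigr => k _; ring.
Qed.

Lemma closure_pos_polys_even p : closure (@pos_polys R d L) p -> even_coefs p.
Proof.
move=> cp; suff : closure [set p : coefs R L | even_coefs p] p.
  by rewrite -(closure_id _).1//; exact: closed_even_coefs.
by move: cp; apply: closureS => q [].
Qed.

Lemma closure_pos_polys_ge0 p t : closure (@pos_polys R d L) p -> torus t ->
  0 <= poly_val p t.
Proof.
move=> cp tt; suff : closure [set p : coefs R L | 0 <= poly_val p t] p.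
  rewrite -(closure_id _).1//.
  apply: (@preimage_closed _ _ (fun p => poly_val p t) [set r | 0 <= r]).
    by move=> q _; exact: continuous_poly_val.
  exact: closed_ge.
by move: cp; apply: closureS => q [_ /(_ t tt)/trig_poly_gt0_val/ltW].
Qed.

Lemma closure_pos_polys1_unit p : closure (@pos_polys1 R d L) p -> unit_const p.
Proof.
move=> cp; suff : closure [set p : coefs R L | unit_const p] p.
  by rewrite -(closure_id _).1//; exact: closed_unit_const.
by move: cp; apply: closureS => q [].
Qed.

Lemma pos_polysP p : even_coefs p -> (forall t, 0 < poly_val p t) ->
  pos_polys p.
Proof. by move=> pe p0; split=> // t _; exact: trig_poly_gt0. Qed.

Definition one_coefs : coefs R L := fun k => (val k == 0)%:R.

Lemma one_coefs_even : even_coefs one_coefs.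
Proof. by move=> k l kl; rewrite /one_coefs kl oppr_eq0. Qed.

Lemma one_coefs_unit : unit_const one_coefs.
Proof. by move=> k k0; rewrite /one_coefs k0 eqxx. Qed.

Lemma poly_val_one t : (0 : 'rV[int]_d) \in L -> poly_val one_coefs t = 1.
Proof.
move=> L0; rewrite poly_valE (bigD1 [` L0]%fset)//= big1 ?addr0.
  rewrite /one_coefs/= eqxx mul1r /pairing big1 ?cos0// => j _.
  by rewrite mxE mul0r.
move=> k k0; rewrite /one_coefs; case: eqP => [kE|]; rewrite ?mul0r//.
by case/negP: k0; apply/eqP/val_inj.
Qed.

End Positivity.
Arguments one_coefs R {d} L _.

Lemma sum_lty (R : realType) (a b : \bar R) (r s : R) :
  (0 <= a -> 0 <= b -> a + r%:E - s%:E + b < +oo -> a < +oo /\ b < +oo)%E.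
Proof. by case: a => [a||]; case: b => [b||] //=; rewrite !ltry. Qed.

Section Interior.
Variables (R : realType) (d : nat) (L : {fset 'rV[int]_d}).
Variables (n : nat) (lambda : R) (c m : L -> R).
Hypothesis d_gt0 : (0 < d)%N.
Hypothesis L0 : (0 : 'rV[int]_d) \in L.
Hypothesis L_opp : forall k : 'rV[int]_d, k \in L -> - k \in L.
Hypothesis dn : (d <= n.+1.*2)%N.
Hypothesis lambda_gt0 : 0 < lambda.
Local Notation mu := (torus_measure R d).
Implicit Types (x : coefs R L * coefs R L).

(** Minimality only serves to make the dual function finite: then both
    integrals converge, the first one forces [P] to be bounded below, and after
    that [P^nu / Q^(nu-1)] dominates a multiple of [1 / Q^(nu-1)]. *)
Lemma dual_solution_above x : dual_solution n.+2 lambda c m x ->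
  exists2 delta, 0 < delta & above delta x.
Proof.
case=> -[/= cl1 cl2] xmin.
have cl1' : closure (@pos_polys R d L) x.1 by move: cl1; apply: closureS => p [].
have P0 t : torus t -> 0 <= poly_val x.1 t by exact: closure_pos_polys_ge0.
have Q0 t : torus t -> 0 <= poly_val x.2 t by exact: closure_pos_polys_ge0.
have one_pos : pos_polys (one_coefs R L).
  apply: pos_polysP => //; first exact: one_coefs_even.
  by move=> t; rewrite poly_val_one.
have := xmin (one_coefs R L, one_coefs R L).
have ab1 : above 1 (one_coefs R L, one_coefs R L).
  by move=> t; rewrite /= poly_val_one.
have /[swap]/[apply] : (closure (@pos_polys1 R d L) `*` closure (@pos_polys R d L))
    (one_coefs R L, one_coefs R L).
  split; apply: subset_closure => //=; split => //; exact: one_coefs_unit.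
rewrite (dual_fun_torus _ _ _ _ ltr01 ab1) => Jle.
have {Jle} : (dual_fun mu n.+2 lambda c m x < +oo)%E by apply: le_lt_trans Jle (ltry _).
rewrite /dual_fun.
set I1 := (\int[mu]_(t in torus) _)%E; set I2 := (\int[mu]_(t in torus) _)%E.
have nu0 : 0 < n.+2%:R - 1 :> R by rewrite -[n.+2%:R]natr1 addrK.
have a0 : 0 < 1 / (n.+2%:R - 1) :> R by rewrite divr_gt0.
have l0 : 0 < lambda / (n.+2%:R - 1) :> R by rewrite divr_gt0.
have I10 : (0 <= I1)%E.
  apply: integral_ge0 => t tt; rewrite mule_ge0 ?inve_ge0 ?lee_fin ?exprn_ge0//.
  - exact: P0.
  - exact: Q0.
have I20 : (0 <= I2)%E.
  apply: integral_ge0 => t tt; rewrite mul1e inve_ge0 lee_fin exprn_ge0//.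
  exact: P0.
have lty (r : R) (I : \bar R) : 0 < r -> (r%:E * I < +oo -> I < +oo)%E.
  by move=> r0; case: I => [s||]; rewrite ?ltry// gt0_muley.
move=> /sum_lty[||/(lty _ _ a0) I1lt /(lty _ _ l0) I2lt].
- by rewrite mule_ge0// lee_fin ltW.
- by rewrite mule_ge0// lee_fin ltW.
have [d1 d10 Pd] : exists2 delta : R, 0 < delta &
    forall t, delta <= poly_val x.1 t.
  apply: (inve_integrable_lower_bound d_gt0 dn P0).
  by move: I2lt; rewrite /I2; under eq_integral do rewrite mul1e.
have [d2 d20 Qd] : exists2 delta : R, 0 < delta &
    forall t, delta <= poly_val x.2 t.
  apply: (inve_integrable_lower_bound d_gt0 dn Q0).
  have k0 : 0 < d1 ^+ n.+2 by exact: exprn_gt0.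
  rewrite ltey; apply/eqP => Iy; move: I1lt; apply/negP; rewrite -leNgt.
  have -> : (+oo = (d1 ^+ n.+2)%:E *
      \int[mu]_(t in torus) ((poly_val x.2 t ^+ n.+1)%:E)^-1)%E.
    by rewrite Iy gt0_muley// lte_fin.
  have mQ : measurable_fun torus (fun t => ((poly_val x.2 t ^+ n.+1)%:E)^-1)%E.
    by apply: measurable_funTS; exact: measurable_inve_poly_val.
  have Q0' t : torus t -> (0 <= ((poly_val x.2 t ^+ n.+1)%:E)^-1)%E.
    by move=> tt; rewrite inve_ge0 lee_fin exprn_ge0// Q0.
  rewrite -ge0_integralZl//; last by rewrite lee_fin ltW.
  apply: ge0_le_integral => //.
  - by move=> t tt; rewrite mule_ge0 ?Q0'// lee_fin ltW.
  - by apply: emeasurable_funM.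
  - apply: emeasurable_funM => //.
    apply/measurable_EFinP/measurable_funTS.
    by apply: measurable_funX; exact: measurable_poly_val.
  - move=> t tt; rewrite lee_wpmul2r ?Q0'// lee_fin.
    by rewrite lerXn2r ?nnegrE ?P0// ltW.
exists (Num.min d1 d2); first by rewrite lt_min d10.
by move=> t; rewrite !ge_min Pd Qd orbT.
Qed.

Lemma dual_solution_admissible x : dual_solution n.+2 lambda c m x ->
  admissible x.
Proof.
case=> -[/= cl1 cl2] _; split.
- by apply: closure_pos_polys_even; move: cl1; apply: closureS => p [].
- exact: closure_pos_polys_even.
- exact: closure_pos_polys1_unit.
Qed.

Lemma dual_solution_le x y (delta : R) : dual_solution n.+2 lambda c m x ->
  above delta x -> 0 < delta -> admissible y -> above delta y ->
  objective n lambda c m (@torus_mean R d) x <=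
  objective n lambda c m (@torus_mean R d) y.
Proof.
move=> [_ xmin] xd d0 [y1 y2 y3] yd.
rewrite -lee_fin -!(dual_fun_torus _ _ _ _ d0)//; apply: xmin.
have y0 t : 0 < poly_val y.1 t /\ 0 < poly_val y.2 t.
  by have [h1 h2] := yd t; split; [exact: lt_le_trans h1|exact: lt_le_trans h2].
have p1 : pos_polys y.1 by apply: pos_polysP => // t; case: (y0 t).
have p2 : pos_polys y.2 by apply: pos_polysP => // t; case: (y0 t).
by split; apply: subset_closure.
Qed.

End Interior.

(** * Strong convexity along the grids *)

Section Perturbation.
Variables (R : realType) (d : nat) (L : {fset 'rV[int]_d}).
Variables (n : nat) (lambda : R) (c m : L -> R).
Hypothesis L_opp : forall k : 'rV[int]_d, k \in L -> - k \in L.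
Hypothesis lambda_gt0 : 0 < lambda.
Implicit Types (x y z : coefs R L * coefs R L) (N : 'I_d -> nat) (u v : R).
Local Notation J N := (objective n lambda c m (grid_mean N)).

Definition mix u v x y : coefs R L * coefs R L :=
  (fun k => u * x.1 k + v * y.1 k, fun k => u * x.2 k + v * y.2 k).

Definition sqdist x y : R :=
  \sum_(k : L) (x.1 k - y.1 k) ^+ 2 + \sum_(k : L) (x.2 k - y.2 k) ^+ 2.

Definition grid_pos N x := forall l : grid_index N,
  0 < poly_val x.1 (grid_point R l) /\ 0 < poly_val x.2 (grid_point R l).

Lemma admissible_mix u v x y : u + v = 1 -> admissible x -> admissible y ->
  admissible (mix u v x y).
Proof.
move=> uv [x1 x2 x3] [y1 y2 y3]; split=> /=.
- by move=> k l kl; rewrite (x1 k l)// (y1 k l).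
- by move=> k l kl; rewrite (x2 k l)// (y2 k l).
- by move=> k k0; rewrite x3// y3// !mulr1.
Qed.

Lemma sqdist_ge0 x y : 0 <= sqdist x y.
Proof. by rewrite addr_ge0// sumr_ge0// => k _; exact: sqr_ge0. Qed.

Lemma sqdist_mix x y u : sqdist (mix (1 - u) u x y) x = u ^+ 2 * sqdist y x.
Proof.
rewrite /sqdist mulrDr !mulr_sumr.
by congr (_ + _); apply: eq_bigr => k _ /=; ring.
Qed.

Lemma sqdist_eq0 x y : sqdist x y <= 0 -> x = y.
Proof.
move=> xy; have h0 := sqdist_ge0 x y.
have s1 : 0 <= \sum_(k : L) (x.1 k - y.1 k) ^+ 2.
  by rewrite sumr_ge0// => k _; exact: sqr_ge0.
have s2 : 0 <= \sum_(k : L) (x.2 k - y.2 k) ^+ 2.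
  by rewrite sumr_ge0// => k _; exact: sqr_ge0.
have z (p q : coefs R L) : \sum_(k : L) (p k - q k) ^+ 2 = 0 -> p = q.
  move=> pq0; apply: functional_extensionality_dep => k.
  move/psumr_eq0P : pq0 => /(_ (fun k _ => sqr_ge0 _)) /(_ k erefl) /eqP.
  by rewrite sqrf_eq0 subr_eq0 => /eqP.
rewrite (surjective_pairing x) (surjective_pairing y).
by congr (_, _); apply: z; move: xy s1 s2; rewrite /sqdist;
  move: (\sum_k _) (\sum_k _) => a b; lra.
Qed.

Lemma sqdist_cube x y (rho : R) : 0 <= rho -> sqdist y x <= rho ^+ 2 ->
  cube x rho y.
Proof.
move=> rho0 yx.
have le (p q : coefs R L) k : (p k - q k) ^+ 2 <= \sum_(k : L) (p k - q k) ^+ 2.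
  rewrite (bigD1 k)//= lerDl sumr_ge0// => l _; exact: sqr_ge0.
have s1 : 0 <= \sum_(k : L) (y.1 k - x.1 k) ^+ 2.
  by rewrite sumr_ge0// => k _; exact: sqr_ge0.
have s2 : 0 <= \sum_(k : L) (y.2 k - x.2 k) ^+ 2.
  by rewrite sumr_ge0// => k _; exact: sqr_ge0.
have fin (p q : coefs R L) k : \sum_(k : L) (p k - q k) ^+ 2 <= rho ^+ 2 ->
    `|p k - q k| <= rho.
  move=> h; rewrite -(ler_pXn2r (n := 2))// ?nnegrE//.
  by rewrite real_normK ?num_real// (le_trans (le p q k)).
by split=> k; apply: fin; move: yx; rewrite /sqdist; lra.
Qed.

Lemma grid_pos_mix N x y u v : grid_pos N x -> grid_pos N y ->
  0 <= u -> 0 <= v -> u + v = 1 -> grid_pos N (mix u v x y).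
Proof.
move=> xN yN u0 v0 uv l; rewrite !poly_val_lin.
have [x1 x2] := xN l; have [y1 y2] := yN l.
have pos (a b : R) : 0 < a -> 0 < b -> 0 < u * a + v * b.
  move=> a0 b0; have [h|h] := leP u (1 / 2).
    by rewrite ltr_wpDl ?mulr_ge0 ?mulr_gt0 ?(ltW a0)//; lra.
  by rewrite ltr_pwDl ?mulr_ge0 ?mulr_gt0 ?(ltW b0)//; lra.
by split; exact: pos.
Qed.

Let lin x : R := \sum_(k : L) x.2 k * c k - \sum_(k : L) x.1 k * m k.

Let lin_mix u v x y : lin (mix u v x y) = u * lin x + v * lin y.
Proof.
rewrite /lin /= !mulrBr !mulr_sumr addrACA -opprD -!big_split/=.
by congr (_ - _); apply: eq_bigr => k _; ring.
Qed.

Let JE N x : J N x = grid_mean N (dual_density n lambda x) + lin x.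
Proof. by rewrite /objective /lin addrA. Qed.

Lemma objective_convex N x y u v :
  grid_pos N x -> grid_pos N y -> 0 <= u -> 0 <= v -> u + v = 1 ->
  J N (mix u v x y) <= u * J N x + v * J N y.
Proof.
move=> xN yN u0 v0 uv; rewrite !JE lin_mix.
rewrite [leRHS](_ : _ = u * grid_mean N (dual_density n lambda x) +
  v * grid_mean N (dual_density n lambda y) + (u * lin x + v * lin y));
  last by ring.
rewrite lerD2r -grid_mean_lin; apply: grid_mean_le => l.
rewrite /dual_density !poly_val_lin.
have [x1 x2] := xN l; have [y1 y2] := yN l.
by apply: density_convex => //; exact: ltW.
Qed.

Lemma above_grid_pos N x (delta : R) : 0 < delta -> above delta x ->
  grid_pos N x.
Proof.
move=> d0 xd l; have [h1 h2] := xd (grid_point R l).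
by split; [exact: lt_le_trans h1|exact: lt_le_trans h2].
Qed.

(** Strong convexity with a modulus that does not depend on the grid: the
    pointwise gap is a mean of squares of trigonometric polynomials, and
    these means are sums of squares of coefficients by Parseval's identity. *)
Lemma objective_midpoint (C delta : R) : 0 <= C -> 0 < delta ->
  exists2 k : R, 0 < k & forall N x y, (forall j, 0 < N j)%N ->
    (forall j, (freq_bound L).*2 < N j)%N ->
    admissible x -> admissible y -> coefs_le C x -> coefs_le C y ->
    above delta x -> above delta y ->
    2 * J N (mix (1 / 2) (1 / 2) x y) + k * sqdist x y <= J N x + J N y.
Proof.
move=> C0 d0; have dM : delta <= C + delta by rewrite lerDr.
have [k k0 hk] := density_midpoint n lambda_gt0 d0 dM.
exists k => // N x y N0 NL [x1 x2 _] [y1 y2 _] [xC1 xC2] [yC1 yC2] xd yd.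
pose h : coefs R L := fun k => 1 * x.1 k + (-1) * y.1 k.
pose g : coefs R L := fun k => 1 * x.2 k + (-1) * y.2 k.
have he : even_coefs h by move=> i j ij; rewrite /h (x1 i j)// (y1 i j).
have ge : even_coefs g by move=> i j ij; rewrite /g (x2 i j)// (y2 i j).
have -> : sqdist x y = grid_mean N (fun t =>
    1 * poly_val h t ^+ 2 + 1 * poly_val g t ^+ 2).
  rewrite grid_mean_lin !mul1r !parseval// /sqdist /h /g.
  by congr (_ + _); apply: eq_bigr => i _; rewrite mul1r mulN1r.
rewrite !JE lin_mix [X in X <= _](_ : _ =
  2 * grid_mean N (dual_density n lambda (mix (1 / 2) (1 / 2) x y)) +
  k * grid_mean N (fun t => 1 * poly_val h t ^+ 2 + 1 * poly_val g t ^+ 2) +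
  (lin x + lin y)); last by field.
rewrite [X in _ <= X](_ : _ = 1 * grid_mean N (dual_density n lambda x) +
  1 * grid_mean N (dual_density n lambda y) + (lin x + lin y)); last by ring.
rewrite lerD2r -!grid_mean_lin; apply: grid_mean_le => l.
move: (grid_point R l) => t; rewrite /dual_density !poly_val_lin.
have bnd (p : coefs R L) : coef_sum p <= C -> delta <= poly_val p t ->
    delta <= poly_val p t <= C + delta.
  move=> pC ->/=; rewrite (le_trans (ler_norm _))//.
  by rewrite (le_trans (poly_val_norm_le _ _))// (le_trans pC)// lerDl ltW.
have [xd1 xd2] := xd t; have [yd1 yd2] := yd t.
have := hk _ _ _ _ (bnd _ xC1 xd1) (bnd _ yC1 yd1) (bnd _ xC2 xd2) (bnd _ yC2 yd2).
rewrite !mul1r !mulN1r; congr (2 * density _ _ _ _ + _ <= _); lra.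
Qed.

Lemma poly_val_dist (p q : coefs R L) (rho : R) t :
  (forall k, `|p k - q k| <= rho) ->
  `|poly_val p t - poly_val q t| <= #|{: L}|%:R * rho.
Proof.
move=> pq; have -> : poly_val p t - poly_val q t =
    poly_val (fun k => 1 * p k + (-1) * q k) t.
  by rewrite poly_val_lin mul1r mulN1r.
rewrite (le_trans (poly_val_norm_le _ _))// /coef_sum.
rewrite mulr_natl -sumr_const; apply: ler_sum => k _.
by rewrite mul1r mulN1r.
Qed.

Lemma coef_sum_dist (p q : coefs R L) (rho : R) :
  (forall k, `|p k - q k| <= rho) -> coef_sum p <= coef_sum q + #|{: L}|%:R * rho.
Proof.
move=> pq; rewrite /coef_sum mulr_natl -sumr_const -big_split/=.
apply: ler_sum => k _; rewrite -[p k](subrK (q k)) addrC.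
by rewrite (le_trans (ler_normD _ _))// lerD.
Qed.

End Perturbation.

Section Grids.
Variables (R : realType) (d : nat).
Implicit Types (N : 'I_d -> nat).

Lemma min_size_le N j : (min_size N <= N j)%N.
Proof.
rewrite /min_size; move: (\max_(i < d) N i)%N => b.
elim: (index_enum _) (mem_index_enum j) => //= i s IH.
rewrite inE big_cons/= => /predU1P[->|/IH]; first exact: geq_minl.
by move=> h; exact: leq_trans (geq_minr _ _) h.
Qed.

Lemma mesh_le (e : R) : 0 < e -> exists n1 : nat, forall N,
  (n1 <= min_size N)%N -> \sum_(j < d) (2 * pi / (N j)%:R) <= e.
Proof.
move=> e0; pose K : R := d%:R * (2 * pi) / e.
have pi0 := pi2_gt0 R.
have K0 : 0 <= K by rewrite divr_ge0 ?(ltW e0)// mulr_ge0// ltW.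
exists (Num.truncn K).+1 => N hN.
have KN j : K < (N j)%:R.
  have /andP[_ h] := truncn_itv K0; apply: lt_le_trans h _.
  by rewrite ler_nat (leq_trans hN)// min_size_le.
have [d0|d0] := posnP d.
  rewrite big1 ?(ltW e0)// => j _; exfalso.
  by have := leq_ltn_trans (leq0n j) (ltn_ord j); rewrite {1}d0.
have dR : 0 < d%:R :> R by rewrite ltr0n.
have -> : e = \sum_(j < d) (e / d%:R).
  by rewrite sumr_const card_ord -[RHS]mulr_natr divfK// gt_eqF.
apply: ler_sum => j _; have Nj : 0 < (N j)%:R :> R := le_lt_trans K0 (KN j).
rewrite ler_pdivrMr// mulrAC ler_pdivlMr// mulrC.
by have := KN j; rewrite /K ltr_pdivrMr// => /ltW; rewrite [e * _]mulrC.
Qed.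

End Grids.

(** * Localization of the discrete minimizers *)

Section Convergence.
Variables (R : realType) (d : nat) (L : {fset 'rV[int]_d}).
Variables (n : nat) (lambda : R) (c m : L -> R).
Hypothesis L_opp : forall k : 'rV[int]_d, k \in L -> - k \in L.
Hypothesis lambda_gt0 : 0 < lambda.
Implicit Types (x y z : coefs R L * coefs R L) (N : 'I_d -> nat).
Local Notation J N := (objective n lambda c m (grid_mean N)).
Local Notation Jinf := (objective n lambda c m (@torus_mean R d)).

Variables (x0 : coefs R L * coefs R L) (delta : R).
Hypothesis delta_gt0 : 0 < delta.
Hypothesis x0_above : above (2 * delta) x0.
Hypothesis x0_adm : admissible x0.
Hypothesis x0_min : forall y, admissible y -> above delta y -> Jinf x0 <= Jinf y.

(* In the cube of radius [rho0] all values stay above [delta] and the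
   coefficients stay bounded by [C], so every constant below is uniform. *)
Let rho0 : R := Num.min 1 (delta / (#|{: L}|%:R + 1)).

Let rho0_gt0 : 0 < rho0.
Proof. by rewrite lt_min ltr01 divr_gt0// ltr_wpDl. Qed.

Let C : R := coef_sum x0.1 + coef_sum x0.2 + #|{: L}|%:R.

Let C_ge0 : 0 <= C.
Proof. by rewrite !addr_ge0 ?coef_sum_ge0. Qed.

Let cube_above x rho : rho <= rho0 -> cube x0 rho x -> above delta x.
Proof.
move=> rr [x1 x2] t; have [h1 h2] := x0_above t.
have Lr : #|{: L}|%:R * rho <= delta.
  have L1 : 0 < #|{: L}|%:R + 1 :> R by rewrite ltr_wpDl.
  have : rho <= delta / (#|{: L}|%:R + 1).
    by rewrite (le_trans rr)// ge_min lexx orbT.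
  rewrite ler_pdivlMr// => h.
  have [r0|r0] := leP 0 rho; first by rewrite mulrC; lra.
  by rewrite (le_trans _ (ltW delta_gt0))// mulr_ge0_le0// ltW.
have near (p q : coefs R L) : (forall k, `|p k - q k| <= rho) ->
    2 * delta <= poly_val q t -> delta <= poly_val p t.
  move=> pq hq; have := le_trans (poly_val_dist t pq) Lr.
  rewrite ler_distl => /andP[h _]; lra.
by split; [exact: near x1 h1|exact: near x2 h2].
Qed.

Let cube_coefs_le x rho : rho <= rho0 -> cube x0 rho x -> coefs_le C x.
Proof.
move=> rr [x1 x2]; have r1 : rho <= 1 by rewrite (le_trans rr)// ge_min lexx.
have Lr : #|{: L}|%:R * rho <= #|{: L}|%:R by rewrite ler_piMr.
have s1 := coef_sum_ge0 x0.1; have s2 := coef_sum_ge0 x0.2.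
by split; rewrite /C; [have := coef_sum_dist x1|have := coef_sum_dist x2]; lra.
Qed.

Let cube_center rho : 0 <= rho -> cube x0 rho x0.
Proof. by move=> r0; split=> k; rewrite subrr normr0. Qed.

(** A feasible [y] at distance at least [rho] from [x0] would give by
    convexity a point [z] at distance exactly [rho] with [J N z <= J N x0].
    Uniform strong convexity then makes the value at the midpoint of [z] and
    [x0] smaller than [J N x0] by a fixed amount, which contradicts the
    minimality of [x0] for [Jinf] once [J N] is uniformly close to [Jinf]. *)
Lemma sublevel_near (rho : R) : 0 < rho -> rho <= rho0 ->
  exists n1 : nat, forall N, (forall j, 0 < N j)%N -> (n1 <= min_size N)%N ->
    (forall j, (freq_bound L).*2 < N j)%N /\
    forall y, admissible y -> grid_pos N y -> J N y <= J N x0 ->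
      sqdist y x0 < rho ^+ 2.
Proof.
move=> r0 rr; have [k k0 hk] := objective_midpoint n c m L_opp lambda_gt0 C_ge0 delta_gt0.
have [D D0 hD] := objective_dist n lambda c m C_ge0 delta_gt0.
have e0 : 0 < k * rho ^+ 2 / 5 / (D + 1).
  by rewrite !divr_gt0 ?mulr_gt0 ?exprn_gt0// ltr_wpDl.
have [n1 hn1] := mesh_le d e0.
(* Two comparisons at [w] and [x0] cost [4/5] of the strong convexity gap
   [k rho^2] in all. *)
exists (maxn n1 (freq_bound L).*2.+1) => N N0; rewrite geq_max => /andP[Nn1 NL].
have {}NL j : ((freq_bound L).*2 < N j)%N by exact: leq_trans NL (min_size_le N j).
split=> // y ya yN yx; rewrite ltNge; apply/negP => ry.
have x0d : above delta x0.
  by move=> t; have := x0_above t; move: delta_gt0; lra.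
have x0N := above_grid_pos delta_gt0 x0d (N := N).
have sq0 : 0 < sqdist y x0 by apply: lt_le_trans ry; exact: exprn_gt0.
pose s := rho / Num.sqrt (sqdist y x0).
have sqrt0 : 0 < Num.sqrt (sqdist y x0) by rewrite sqrtr_gt0.
have s0 : 0 <= s by rewrite divr_ge0 ?(ltW r0) ?(ltW sqrt0).
have s1 : s <= 1.
  rewrite ler_pdivrMr// mul1r -(ger0_norm (ltW r0)) -sqrtr_sqr.
  exact: ler_wsqrtr.
pose z := mix (1 - s) s x0 y.
have s10 : 0 <= 1 - s by rewrite subr_ge0.
have s11 : 1 - s + s = 1 by rewrite subrK.
have za : admissible z by exact: admissible_mix.
have zx : sqdist z x0 = rho ^+ 2.
  rewrite sqdist_mix /s expr_div_n sqr_sqrtr ?(ltW sq0)// divfK//.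
  by rewrite gt_eqF.
have zJ : J N z <= J N x0.
  have := objective_convex n c m lambda_gt0 x0N yN s10 s0 s11 => /le_trans; apply.
  by have := ler_wpM2l s0 yx; move: (J N y) (J N x0) => a b h; lra.
have zc : cube x0 rho z by apply: sqdist_cube; [exact: ltW|rewrite zx].
have x0c := cube_center (ltW r0).
(* The midpoint stays in the cube, where [J N] and [Jinf] are close. *)
pose w := mix (1 / 2) (1 / 2) z x0.
have w2 : 1 / 2 + 1 / 2 = 1 :> R by lra.
have wa : admissible w by apply: admissible_mix.
have wc : cube x0 rho w.
  have half (a b : R) : `|a - b| <= rho -> `|1 / 2 * a + 1 / 2 * b - b| <= rho.
    have -> : 1 / 2 * a + 1 / 2 * b - b = 1 / 2 * (a - b) by field.
    move=> ab; rewrite normrM ger0_norm; last by lra.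
    by have := normr_ge0 (a - b); lra.
  by case: zc => z1 z2; split=> i; apply: half; [exact: z1|exact: z2].
have := hk N z x0 N0 NL za x0_adm (cube_coefs_le rr zc) (cube_coefs_le rr x0c)
  (cube_above rr zc) (cube_above rr x0c).
rewrite zx -/w => strong.
have mesh : D * \sum_(j < d) (2 * pi / (N j)%:R) <= k * rho ^+ 2 / 5.
  have D1 : 0 < D + 1 by rewrite ltr_wpDl.
  apply: (@le_trans _ _ (D * (k * rho ^+ 2 / 5 / (D + 1)))).
    by rewrite ler_wpM2l// hn1.
  rewrite mulrA ler_pdivrMr// mulrC ler_wpM2l ?lerDl//.
  by rewrite !mulr_ge0 ?(ltW k0) ?exprn_ge0 ?(ltW r0)// invr_ge0.
have := le_trans (hD w N (cube_coefs_le rr wc) (cube_above rr wc) N0) mesh.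
rewrite ler_distl => /andP[_ wd].
have := le_trans (hD x0 N (cube_coefs_le rr x0c) (cube_above rr x0c) N0) mesh.
rewrite ler_distl => /andP[xd _].
have wm := x0_min wa (cube_above rr wc).
have : 0 < k * rho ^+ 2 by rewrite mulr_gt0 ?exprn_gt0.
move: strong zJ wd xd wm.
move: (J N w) (J N z) (J N x0) (Jinf w) (Jinf x0) (k * rho ^+ 2) => *.
lra.
Qed.

Lemma grid_dual_solutionP N x : (forall j, 0 < N j)%N ->
  grid_dual_solution N n.+2 lambda c m x <->
  [/\ admissible x, grid_pos N x &
    forall y, admissible y -> grid_pos N y -> J N x <= J N y].
Proof.
move=> N0.
have feas y : grid_feasible N y <-> admissible y /\ grid_pos N y.
  split=> [[y1 y2 y3 yN]|[[y1 y2 y3] yN]]; last first.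
    by split=> // t [l _ <-]; have [h1 h2] := yN l; split; exact: trig_poly_gt0.
  split=> // l; have [|h1 h2] := yN (grid_point R l); first by exists l.
  by split; exact: trig_poly_gt0_val.
have gridE y : grid_pos N y ->
    dual_fun (grid_measure N) n.+2 lambda c m y = (J N y)%:E.
  by move=> yN; apply: dual_fun_grid => t [l _ <-]; exact: yN.
split=> [[/feas[xa xN] xmin]|[xa xN xmin]].
  split=> // y ya yN; rewrite -lee_fin -!gridE//.
  by apply: xmin; apply/feas.
split; first exact/feas.
by move=> y /feas[ya yN]; rewrite !gridE// lee_fin xmin.
Qed.

Lemma near_solution (rho : R) : 0 < rho ->
  exists n1 : nat, forall N, (forall j, 0 < N j)%N -> (n1 <= min_size N)%N ->
    forall x, grid_dual_solution N n.+2 lambda c m x -> cube x0 rho x.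
Proof.
move=> r0; pose r := Num.min rho rho0.
have ge_rho : r <= rho0 by rewrite ge_min lexx orbT.
have r_gt0 : 0 < r by rewrite lt_min r0.
have [n1 hn1] := sublevel_near r_gt0 ge_rho.
exists n1 => N N0 Nn x /(grid_dual_solutionP _ N0)[xa xN xmin].
have [_ /(_ x xa xN)] := hn1 N N0 Nn.
have x0d : above delta x0.
  by move=> t; have := x0_above t; move: delta_gt0; lra.
move=> /(_ (xmin _ x0_adm (above_grid_pos delta_gt0 x0d (N := N)))) /ltW h.
have [x1 x2] := sqdist_cube (ltW r_gt0) h.
by split=> k; [apply: le_trans (x1 k) _|apply: le_trans (x2 k) _];
  rewrite ge_min lexx.
Qed.

(** Existence: the minimum over a compact cube is global because every point
    outside has a larger value than [x0]. Uniqueness: strong convexity at the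
    midpoint of two minimizers, both of which lie in the cube. *)
Lemma unique_solution : exists n1 : nat,
  forall N, (forall j, 0 < N j)%N -> (n1 <= min_size N)%N ->
    exists! x, grid_dual_solution N n.+2 lambda c m x.
Proof.
have [n1 hn1] := sublevel_near rho0_gt0 (lexx _).
exists n1 => N N0 Nn; have [NL near] := hn1 N N0 Nn.
have x0c := cube_center (ltW rho0_gt0).
have inK y : cube x0 rho0 y -> grid_pos N y.
  by move=> yc; exact: above_grid_pos delta_gt0 (cube_above (lexx _) yc).
have sol_cube y : admissible y -> grid_pos N y -> J N y <= J N x0 ->
    cube x0 rho0 y.
  by move=> ya yN h; apply: sqdist_cube; [exact: ltW|exact/ltW/near].
have [|||x] := @compact_EVT_min _ _ (J N) (cube x0 rho0 `&` @admissible R d L).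
- by exists x0.
- apply: compact_closedI; [exact: compact_cube|exact: closed_admissible].
- apply: continuous_in_subspaceT => y /[!inE] -[yc _].
  by apply: continuous_at_objective => t [l _ <-]; exact: inK.
rewrite inE => -[xc xa] xmin.
have solx : grid_dual_solution N n.+2 lambda c m x.
  apply/grid_dual_solutionP => //; split=> //; first exact: inK.
  move=> y ya yN; have [h|h] := leP (J N y) (J N x0).
    by apply: xmin; rewrite inE; split => //; exact: sol_cube.
  apply: le_trans (ltW h); apply: xmin; rewrite inE; split => //.
exists x; split=> // y soly.
move/(grid_dual_solutionP _ N0): solx => [_ xN xmin'].
move/(grid_dual_solutionP _ N0): soly => [ya yN ymin].
have yc : cube x0 rho0 y by apply: sol_cube => //; exact: ymin (inK _ x0c).
have [k k0 hk] := objective_midpoint n c m L_opp lambda_gt0 C_ge0 delta_gt0.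
have strong := hk N x y N0 NL xa ya (cube_coefs_le (lexx _) xc)
  (cube_coefs_le (lexx _) yc) (cube_above (lexx _) xc) (cube_above (lexx _) yc).
have h2 : 1 / 2 + 1 / 2 = 1 :> R by lra.
have h0 : 0 <= 1 / 2 :> R by lra.
have ma := admissible_mix h2 xa ya; have mN := grid_pos_mix xN yN h0 h0 h2.
have m1 := xmin' _ ma mN; have m2 := ymin _ ma mN.
apply: sqdist_eq0; rewrite -(pmulr_rle0 _ k0); lra.
Qed.

Lemma coef_norm_cube x rho : cube x0 rho x -> coef_norm x <=
  Num.sqrt (\sum_(k : L) (`|x0.1 k| + rho) ^+ 2) +
  Num.sqrt (\sum_(k : L) (`|x0.2 k| + rho) ^+ 2).
Proof.
move=> [x1 x2].
have le (p q : coefs R L) k : (forall k, `|p k - q k| <= rho) ->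
    `|p k| ^+ 2 <= (`|q k| + rho) ^+ 2.
  move=> h; have r0 : 0 <= rho := le_trans (normr_ge0 _) (h k).
  rewrite lerXn2r ?nnegrE ?addr_ge0//.
  by rewrite -[p k](subrK (q k)) addrC (le_trans (ler_normD _ _))// lerD2l.
rewrite /coef_norm lerD// ler_sqrt ?sumr_ge0//;
  try by move=> k _; exact: sqr_ge0.
  rewrite big_mkcond/=; apply: ler_sum => k _; case: ifP => _; first exact: le.
  exact: sqr_ge0.
by apply: ler_sum => k _; exact: le.
Qed.

End Convergence.

(** * The limit theorem *)

Theorem theorem7p6 (R : realType) (d : nat) (L : {fset 'rV[int]_d})
    (nu : nat) (lambda : R) (c m : L -> R) (phat qhat : coefs R L) :
  (0 < d)%N ->
  (0 : 'rV[int]_d) \in L ->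
  (forall k : 'rV[int]_d, k \in L -> - k \in L) ->
  d%:R / 2 + 1 <= nu%:R :> R ->
  0 < lambda ->
  even_coefs c ->
  even_coefs m ->
  (exists Phi0 : d.-tuple R -> R,
    [/\ (torus_measure R d).-integrable (@torus R d) (EFin \o Phi0),
        forall t, torus t -> 0 <= Phi0 t,
        exists t0 : d.-tuple R, exists r : R,
          [/\ torus t0, 0 < r & forall t, torus_ball t0 r t -> 0 < Phi0 t]
      & forall k : L, (c k)%:C%C = fourier_coef Phi0 (val k)]) ->
  dual_solution nu lambda c m (phat, qhat) ->
  exists n0 : nat,
    (forall N : 'I_d -> nat, (forall j, 0 < N j)%N -> (n0 <= min_size N)%N ->
      exists! x : coefs R L * coefs R L,
        grid_dual_solution N nu lambda c m x) /\
    (forall (N : nat -> 'I_d -> nat) (x : nat -> coefs R L * coefs R L),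
      (forall n j, 0 < N n j)%N ->
      (forall n, n0 <= min_size (N n))%N ->
      min_size (N n) @[n --> \oo] --> \oo ->
      (forall n, grid_dual_solution (N n) nu lambda c m (x n)) ->
      (exists M : R, forall n, coef_norm (x n) <= M) /\
      cluster (x @ \oo) = [set (phat, qhat)]).
Proof.
move=> d0 L0 Lopp dnu lam0 _ _ _ sol.
have [n nuE] : exists n, nu = n.+2.
  have nu1 : (1 < nu)%N.
    rewrite -(ltr_nat R); apply: lt_le_trans dnu.
    by rewrite ltrDr divr_gt0// ltr0n.
  by exists nu.-2; case: (nu) nu1 => [|[]].
subst nu.
have dn : (d <= n.+1.*2)%N.
  rewrite -(ler_nat R) -muln2 natrM.
  by move: dnu; rewrite -[n.+2%:R]natr1 lerD2r ler_pdivrMr.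
have [delta delta0 ab] := dual_solution_above d0 L0 Lopp dn lam0 sol.
pose e := delta / 2; have e0 : 0 < e by rewrite divr_gt0.
have ab2 : above (2 * e) (phat, qhat) by rewrite /e mulrC divfK.
have abe : above e (phat, qhat).
  by move=> t; have := ab t; rewrite /e /=; lra.
have adm := dual_solution_admissible sol.
have min y : admissible y -> above e y -> _ :=
  dual_solution_le Lopp sol abe e0 (y := y).
have [n0 uniq0] := unique_solution Lopp lam0 e0 ab2 adm min.
have near := near_solution Lopp lam0 e0 ab2 adm min.
have [n1 near1] := near 1 ltr01.
exists (maxn n0 n1); split=> [N N0 hN|N x N0 hN Noo solx].
  by apply: uniq0 => //; apply: leq_trans hN; exact: leq_maxl.
have cube1 k : cube (phat, qhat) 1 (x k).
  apply: (near1 (N k)) => //; apply: leq_trans (hN k); exact: leq_maxr.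
split.
  by eexists => k; exact: coef_norm_cube (cube1 k).
apply: (cluster_coordwise cube1) => r r0; have [n2 near2] := near r r0.
have : \forall k \near \oo, (n2 <= min_size (N k))%N.
  exact: (Noo [set i | (n2 <= i)%N] (nbhs_infty_ge n2)).
by apply: filterS => k hk; apply: (near2 (N k)).
Qed.
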